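(* Let $(\mathcal X,\rho,\mu)$ be a space of homogeneous type with constants $K_1,K_2$, equipped with a dyadic filtration $\{\mathbb C_n\}_{n\in\mathbb Z}$. Let $p,q\in(1,\infty)$, $\varepsilon>0$, $K_0\ge 1$, $w\in A_q$ with $[w]_{A_q}\le K_0$, and $f\in L_p(w\,d\mu)$ (with $f\in L_{1,\mathrm{loc}}(\mathcal X,\mu)$, so that $f^{\#}_{\mathrm{dy}}$ is defined). Write $\omega(A)=\int_A w\,d\mu$. (i) When $\mu(\mathcal X)<\infty$, we have $$\|f\|_{L_p(w\,d\mu)}\le N\|f^{\#}_{\mathrm{dy}}\|_{L_p(w\,d\mu)}+N(\mu(\mathcal X))^{-1}\big(\omega(\operatorname{supp} f)\big)^{1/p}\|f\|_{L_1(\mu)}.$$ If in addition $\operatorname{supp} f\subset B_{r_0}(x_0)$ and $\mu(B_{r_0}(x_0))\le\varepsilon\mu(\mathcal X)$ for some $r_0\in(0,\infty)$ and $x_0\in\mathcal X$, then $$\|f\|_{L_p(w\,d\mu)}\le N\|f^{\#}_{\mathrm{dy}}\|_{L_p(w\,d\mu)}+N\varepsilon\|f\|_{L_p(w\,d\mu)}.$$ Here $N=N(K_1,K_2,p,q,K_0)>0$. In particular, when $\varepsilon$ is sufficiently small depending on $K_1,K_2,p,q,K_0$, it holds that $$\|f\|_{L_p(w\,d\mu)}\le N\|f^{\#}_{\mathrm{dy}}\|_{L_p(w\,d\mu)}.\qquad( * )$$ (ii) When $\mu(\mathcal X)=\infty$, inequality $( * )$ holds, with $N=N(K_1,K_2,p,q,K_0)>0$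 (with no condition on the support of $f$).
   Context: Space of homogeneous type: $\mathcal X$ is a set with a quasi-metric $\rho$, i.e. a nonnegative symmetric function with $\rho(x,y)=0$ iff $x=y$ and $\rho(x,y)\le K_1(\rho(x,z)+\rho(z,y))$; $B_r(x)=\{y:\rho(x,y)<r\}$; balls are assumed open; $\mu$ is a complete Borel measure on a $\sigma$-algebra containing all balls, with $0<\mu(B_{2r}(x))\le K_2\mu(B_r(x))<\infty$ for all $x\in\mathcal X$, $r>0$; the Lebesgue differentiation theorem is assumed to hold in $(\mathcal X,\mu)$. Dyadic filtration (exists by Christ's theorem): for each $n\in\mathbb Z$ a collection $\mathbb C_n=\{Q^n_\alpha:\alpha\in I_n\}$ of disjoint open subsets of $\mathcal X$ such that (1) $\mu(\mathcal X\setminus\bigcup_\alpha Q^n_\alpha)=0$; (2) for each $n$ and $\alpha\in I_n$ there is a unique $\beta\in I_{n-1}$ with $Q^n_\alpha\subset Q^{n-1}_\beta$; (3) $\operatorname{diam}(Q^n_\alpha)\le N_0\delta^n$; (4) each $Q^n_\alpha$ contains some ball $B_{\varepsilon_0\delta^n}(z^n_\alpha)$; here $\delta\in(0,1)$, $\varepsilon_0>0$, $N_0$ depend only on $K_1,K_2$. Set $\tilde{\mathcal X}=\bigcap_n\bigcup_\alpha Q^n_\alpha$, a set of full measure. $\frac{1}{\mu(A)}\int_A$ denotes averages. For $f\in L_{1,\mathrm{loc}}(\mathcal X,\mu)$ (integrable on balls) and $x\in Q^n_\alpha$, $f_{|n}(x)=\frac1{\mu(Q^n_\alpha)}\int_{Q^n_\alpha}f\,d\mu$,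 and for $x\in\tilde{\mathcal X}$ the dyadic sharp function is $$f^{\#}_{\mathrm{dy}}(x)=\sup_{n<\infty}\frac1{\mu(Q^n_\alpha)}\int_{Q^n_\alpha\ni x}|f(y)-f_{|n}(x)|\,\mu(dy),$$ extended by zero to $\mathcal X\setminus\tilde{\mathcal X}$. For $p\in(1,\infty)$, $A_p$ is the set of nonnegative measurable $w$ on $\mathcal X$ with $$[w]_{A_p}=\sup_{x_0\in\mathcal X,r>0}\Big(\frac1{\mu(B_r(x_0))}\int_{B_r(x_0)}w\,d\mu\Big)\Big(\frac1{\mu(B_r(x_0))}\int_{B_r(x_0)}w^{-1/(p-1)}\,d\mu\Big)^{p-1}<\infty$$ (in particular $w>0$ a.e.). $\|f\|_{L_p(w\,d\mu)}^p=\int|f|^pw\,d\mu$. $N=N(\cdots)$ means a constant depending only on the listed quantities. *)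

(* Defs.v *)
From HB Require Import structures.
From mathcomp Require Import all_boot all_order all_algebra.
From mathcomp Require Import all_classical all_reals all_analysis.

Set Implicit Arguments.
Unset Strict Implicit.
Unset Printing Implicit Defensive.

Import Order.TTheory GRing.Theory Num.Theory.
Import numFieldNormedType.Exports.

Local Open Scope classical_set_scope.
Local Open Scope ring_scope.

Section QuasiMetric.
Context {R : realType} {X : Type}.
Implicit Types (rho : X -> X -> R) (A : set X).

Record quasi_metric (K1 : R) rho : Prop := {
  quasi_metric_ge0 : forall x y, 0 <= rho x y ;
  quasi_metric_sym : forall x y, rho x y = rho y x ;
  quasi_metric_eq0 : forall x y, rho x y = 0 <-> x = y ;
  quasi_metric_triangle :
    forall x y z, rho x y <= K1 * (rho x z + rho z y) }.

Definition qball rho (x : X) (r : R) : set X := [set y | rho x y < r].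

(* The topology induced by a quasi-metric. Balls need not be open in it; this
   is a separate hypothesis on [rho] below. *)
Definition qopen rho A : Prop :=
  forall x, A x -> exists2 r, 0 < r & qball rho x r `<=` A.

Definition qdiam rho A : \bar R :=
  ereal_sup [set (rho xy.1 xy.2)%:E | xy in A `*` A].

End QuasiMetric.

Section Averages.
Context {d : measure_display} {X : measurableType d} {R : realType}.
Variables (mu : {measure set X -> \bar R}) (rho : X -> X -> R).

(* Only meant for sets [A] with [0 < mu A < +oo]. *)
Definition avge (A : set X) (g : X -> \bar R) : \bar R :=
  ((mu A)^-1 * \int[mu]_(y in A) g y)%E.

Definition avg (A : set X) (f : X -> R) : R := fine (avge A (EFin \o f)).

Definition loc_integrable (f : X -> R) : Prop :=
  forall x r, 0 < r -> mu.-integrable (qball rho x r) (EFin \o f).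

Definition lebesgue_differentiation : Prop :=
  forall f, loc_integrable f ->
    {ae mu, forall x, avg (qball rho x r) f @[r --> 0^'+] --> f x}.

End Averages.

Section HomogeneousType.
Context {d : measure_display} {X : measurableType d} {R : realType}.

(* By [homogeneous_measurable] the measure is Borel; with
   [homogeneous_ball_open], its sigma-algebra contains all balls. *)
Record homogeneous_space (K1 K2 : R) (rho : X -> X -> R)
    (mu : {measure set X -> \bar R}) : Prop := {
  homogeneous_metric : quasi_metric K1 rho ;
  homogeneous_ball_open : forall x r, 0 < r -> qopen rho (qball rho x r) ;
  homogeneous_measurable : forall A, qopen rho A -> measurable A ;
  homogeneous_complete : measure_is_complete mu ;
  homogeneous_ball_gt0 :
    forall x r, 0 < r -> (0 < mu (qball rho x (2 * r)))%E ;
  homogeneous_doubling : forall x r, 0 < r ->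
    (mu (qball rho x (2 * r)) <= K2%:E * mu (qball rho x r))%E ;
  homogeneous_ball_fin :
    forall x r, 0 < r -> (K2%:E * mu (qball rho x r) < +oo)%E ;
  homogeneous_differentiation : lebesgue_differentiation mu rho }.

Record dyadic_filtration (delta eps0 N0 : R) (rho : X -> X -> R)
    (mu : {measure set X -> \bar R})
    (I : int -> Type) (Q : forall n, I n -> set X) : Prop := {
  dyadic_open : forall n (a : I n), qopen rho (Q n a) ;
  dyadic_disjoint : forall n, trivIset setT (Q n) ;
  dyadic_full : forall n, mu (~` \bigcup_a Q n a) = 0%E ;
  dyadic_nested :
    forall n (a : I n), exists! b : I (n - 1), Q n a `<=` Q (n - 1) b ;
  dyadic_diam :
    forall n (a : I n), (qdiam rho (Q n a) <= (N0 * delta ^ n)%:E)%E ;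
  dyadic_ball : forall n (a : I n),
    exists z, qball rho z (eps0 * delta ^ n) `<=` Q n a }.

Definition dyadic_core (I : int -> Type) (Q : forall n, I n -> set X) : set X :=
  \bigcap_n \bigcup_a Q n a.

Definition dyadic_sharp (mu : {measure set X -> \bar R})
    (I : int -> Type) (Q : forall n, I n -> set X) (f : X -> R) : X -> \bar R :=
  patch (fun=> 0%E) (dyadic_core Q) (fun x =>
    ereal_sup [set s | exists n (a : I n), Q n a x /\
      s = avge mu (Q n a) (fun y => `|f y - avg mu (Q n a) f|%:E)]).

(* The last factor is the average of [w^(-1/(p-1))], with value [+oo] where
   [w] vanishes: in [\bar R], [0^-1 = +oo], whereas [0 `^ r = 0] for [r != 0]. *)
Definition Ap_constant (mu : {measure set X -> \bar R}) (rho : X -> X -> R)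
    (p : R) (w : X -> R) : \bar R :=
  ereal_sup [set s | exists x r, 0 < r /\
    s = (avge mu (qball rho x r) (EFin \o w) *
         avge mu (qball rho x r) (fun y => ((w y `^ (p - 1)^-1)%:E)^-1)
           `^ (p - 1))%E].

(* [Ap_ae_gt0] rules out weights such as [w = 0], whose constant is finite only
   because of the convention [0 * +oo = 0]. *)
Record Ap_weight (mu : {measure set X -> \bar R}) (rho : X -> X -> R)
    (p : R) (w : X -> R) : Prop := {
  Ap_ge0 : forall x, 0 <= w x ;
  Ap_measurable : measurable_fun setT w ;
  Ap_ae_gt0 : {ae mu, forall x, 0 < w x} ;
  Ap_finite : (Ap_constant mu rho p w < +oo)%E }.

Definition weight_measure (mu : {measure set X -> \bar R}) (w : X -> R)
    (A : set X) : \bar R := (\int[mu]_(x in A) (w x)%:E)%E.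

Definition wLnorm (mu : {measure set X -> \bar R}) (p : R) (w : X -> R)
    (g : X -> \bar R) : \bar R :=
  ((\int[mu]_x (`|g x| `^ p * (w x)%:E)) `^ p^-1)%E.

Definition in_wLp (mu : {measure set X -> \bar R}) (p : R) (w f : X -> R) :=
  measurable_fun setT f /\ (wLnorm mu p w (EFin \o f) < +oo)%E.

(* The set-theoretic support; it lies in every closed support of [f]. *)
Definition supp (f : X -> R) : set X := [set x | f x != 0].

End HomogeneousType.

(* Main.v *)
Require Import Defs.
From HB Require Import structures.
From mathcomp Require Import all_boot all_order all_algebra.
From mathcomp Require Import all_classical all_reals all_analysis.
From mathcomp Require Import finmap measurable_realfun.
From mathcomp Require Import measurable_fun_approximation.
From mathcomp Require Import zify ring lra.

Set Implicit Arguments.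
Unset Strict Implicit.
Unset Printing Implicit Defensive.

Import Order.TTheory GRing.Theory Num.Theory.
Import numFieldNormedType.Exports.

Local Open Scope classical_set_scope.
Local Open Scope ring_scope.

(** The argument runs on the dyadic cubes alone. Doubling and the pointwise
    bound [1 <= t w + (t w)^(-1/(q-1))] give, for a cube [A] and [E] in [A] with
    [mu A <= M mu E], the estimate [w(A) <= C(M) w(E)]; taking complements,
    [2 mu E <= mu A] implies [w(E) <= theta w(A)] with a fixed [theta < 1]. No
    reverse Hölder inequality is needed: a good-lambda inequality between the
    levels [lam] and [a lam], with [a > 1] so close to [1] that [a^p theta < 1],
    is enough. It bounds [|f|^p w] on a cube by [f#^p w] and the mean of [|f|].
    The mean is then absorbed: if [E] is a fixed portion of the cube, either the
    oscillation of [f] is comparable to the mean, or [|f|] is comparable to it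
    on most of [E].
    When [mu X] is finite, [X] is itself a cube, and [E] is [{f = 0}], unless
    [supp f] carries half of the mass. When [mu X] is infinite, [E] is the
    complement of a cube in a much larger one, and the integral of [|f|^p w]
    over [E] tends to [0]. *)

(** The [A_q] condition and the differentiation theorem speak of balls, the sharp function of cubes.
    Both are transferred through one ball: centered in the cube, with the radius of the parent
    level, so that it contains the cube and its parent and has measure at most a fixed multiple of
    that of the cube. The good-lambda inequality is localized to subcubes of a cube [Q0] whose mean
    of [|f|] is at most [L], with levels [a^k L]. All weights are then finite, and a sum over
    finitely many levels can be absorbed before monotone convergence removes the truncation.
    Finiteness of the integral of [|f|^p w] enters when [mu X] is infinite, where the integral
    outside a large cube is absorbed. In that case the union of the ancestors of one cube may miss a
    large part of [X]: for the dyadic intervals of the line it is a half-line. The estimate is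
    therefore proved on each such union; there are countably many, pairwise disjoint, and they fill
    [X] up to a null set. *)

(** * Disjoint families of sets and the pointwise inequality for weights *)

Section MeasureTheory.
Context {d : measure_display} {T : measurableType d} {R : realType}.
Variable mu : {measure set T -> \bar R}.
Implicit Types (A B E : set T) (F : set (set T)) (g h : T -> \bar R).
Local Open Scope ereal_scope.

Lemma subset_measure_le A B :
  measurable A -> measurable B -> A `<=` B -> mu A <= mu B.
Proof. by move=> mA mB AB; apply: le_measure => //; exact/mem_set. Qed.

Lemma le_integral_disjoint_cover F g h :
  countable F -> (forall A, F A -> measurable A) -> trivIset F id ->
  measurable_fun setT g -> measurable_fun setT h ->
  (forall x, 0 <= g x) -> (forall x, 0 <= h x) ->
  (forall A, F A -> \int[mu]_(x in A) g x <= \int[mu]_(x in A) h x) ->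
  \int[mu]_(x in \bigcup_(A in F) A) g x <=
  \int[mu]_(x in \bigcup_(A in F) A) h x.
Proof.
move=> /countable_injP[/= e einj] mF tF mg mh g0 h0 gh.
have {}einj A B : F A -> F B -> e A = e B -> A = B.
  by move=> FA FB; apply: einj; exact/mem_set.
(* [U k] is the member numbered [k], or empty if there is none; this makes the family a disjoint
   sequence. *)
pose U k := \bigcup_(A in F `&` e @^-1` [set k]) A.
have UP k : U k = set0 \/ F (U k).
  have [[A [FA eA]]|noA] := pselect (exists A, F A /\ e A = k).
    right; suff -> : U k = A by [].
    apply/seteqP; split=> [x [B [FB /= eB]]|x Ax]; last by exists A.
    by rewrite (einj B A)// eA.
  left; apply/seteqP; split=> // x [B [FB /= eB] _].
  by apply: noA; exists B.
have mU k : measurable (U k) by case: (UP k) => [->//|/mF].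
have -> : \bigcup_(A in F) A = \bigcup_k U k.
  apply/seteqP; split=> [x [A FA Ax]|x [k _ [A [FA _] Ax]]]; last by exists A.
  by exists (e A) => //; exists A.
have tU : trivIset setT U.
  move=> i j _ _ [x [[A [FA /= <-] Ax] [B [FB /= <-] Bx]]].
  by rewrite (tF A B FA FB)//; exists x.
have mUU : measurable (\bigcup_k U k) by exact: bigcup_measurable.
rewrite !ge0_integral_bigcup//=; last 2 first.
  exact: measurable_funTS.
  exact: measurable_funTS.
apply: lee_nneseries => k _; first by move=> _; apply: integral_ge0 => x _.
by case: (UP k) => [->|/gh//]; rewrite !integral_set0.
Qed.

(** Pigeonhole: at most [(n+1) mu B] disjoint sets can meet [B] in measure more than [1/(n+1)]. The
    index types [I n] of the filtration are arbitrary, and the countability of each generation of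
    cubes comes from here. *)
Lemma countable_disjoint_gt0 F B :
  measurable B -> mu B < +oo -> trivIset F id ->
  (forall A, F A -> measurable A /\ 0 < mu (A `&` B)) -> countable F.
Proof.
move=> mB Bfin tF FP.
pose G n := F `&` [set A | n.+1%:R^-1%:E < mu (A `&` B)].
have -> : F = \bigcup_n G n.
  apply/seteqP; split=> [A FA|A [n _ []]//].
  have [_ A0] := FP _ FA.
  have Afin : mu (A `&` B) \is a fin_num.
    rewrite ge0_fin_numE//; apply: le_lt_trans Bfin.
    apply: subset_measure_le => //.
    by apply: measurableI => //; have [] := FP _ FA.
  have r0 : (0 < fine (mu (A `&` B)))%R.
    by rewrite -lte_fin fineK.
  have [n hn] := ltr_add_invr r0.
  exists n => //; split=> //=.
  by rewrite -[ltRHS]fineK// lte_fin -[ltLHS]add0r.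
apply: bigcup_countable => // n _; apply: finite_set_countable.
apply: contrapT.
move=> /(@infinite_set_fset _ _ (Num.truncn (fine (mu B) * n.+1%:R)).+1)[C CG hC].
have CF A : A \in C -> F A /\ n.+1%:R^-1%:E < mu (A `&` B).
  by move=> AC; have [] := CG A AC.
have : \sum_(A <- C) n.+1%:R^-1%:E <= mu B.
  apply: (@le_trans _ _ (\sum_(A <- C) mu (A `&` B))).
    by rewrite big_seq [leRHS]big_seq; apply: lee_sum => A /CF[_ /ltW].
  have tC : trivIset [set` C] (fun A => A `&` B).
    move=> A A' /= /CF[FA _] /CF[FA' _] [x [[Ax _] [A'x _]]].
    by apply: (tF A A' FA FA'); exists x.
  have mC A : A \in C -> measurable (A `&` B).
    by move=> /CF[/FP[mA _] _]; exact: measurableI.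
  rewrite -(@measure_fbigsetU _ _ _ mu)// -bigcup_fset.
  apply: subset_measure_le => //; last by move=> x [A _ []].
  by apply: fin_bigcup_measurable => //; exact: finite_fset.
rewrite sumEFin big_const_seq count_predT iter_addr_0.
rewrite -[X in _ <= X -> _]fineK ?ge0_fin_numE// lee_fin -(mulr_natl n.+1%:R^-1).
rewrite ler_pdivrMr// => h.
have := truncnS_gt (fine (mu B) * n.+1%:R).
by rewrite ltNge (le_trans _ h)// ler_nat.
Qed.

Lemma integral_gt0 A g : measurable A -> 0 < mu A ->
  measurable_fun setT g -> (forall x, 0 <= g x) -> {ae mu, forall x, 0 < g x} ->
  0 < \int[mu]_(x in A) g x.
Proof.
move=> mA A0 mg g0 gae; rewrite lt0e integral_ge0// andbT.
apply/negP => /eqP g_eq0.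
have : ae_eq mu A g (cst 0).
  apply/ae_eq_integral_abs => //; first exact: measurable_funTS.
  by rewrite -g_eq0; apply: eq_integral => x _; rewrite gee0_abs.
move=> [N1 [mN1 N10 sub1]].
have [N2 [mN2 N20 sub2]] := gae.
have : mu A <= mu (N1 `|` N2).
  apply: subset_measure_le => //; first exact: measurableU.
  move=> x Ax; have [gx|gx] := pselect (0 < g x).
    by left; apply: sub1 => /= /(_ Ax) gx0; move: gx; rewrite gx0 ltxx.
  by right; apply: sub2.
move=> /le_trans /(_ (measureU2 _ mN1 mN2)).
by rewrite [X in X + _]N10 [X in _ + X]N20 adde0 leNgt A0.
Qed.

(** The first term suffices if [t u >= 1], the second otherwise. At [u = 0] the extended inverse is
    [+oo]. *)
Lemma one_le_weight_sum (s t u : R) : (0 < s)%R -> (0 < t)%R -> (0 <= u)%R ->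
  1 <= t%:E * u%:E + (t `^ (- s))%:E * ((u `^ s)%:E)^-1.
Proof.
move=> s0 t0 u0.
have inv0 : (0 <= (t `^ (- s))%:E * ((u `^ s)%:E)^-1)%E.
  by rewrite mule_ge0 ?lee_fin ?powR_ge0// inve_ge0 lee_fin powR_ge0.
have [tu|tu] := leP 1%R (t * u)%R.
  by rewrite -[leLHS]adde0 leeD// lee_fin.
rewrite -[leLHS]add0e leeD//; first by rewrite lee_fin mulr_ge0// ltW.
have [->|un0] := eqVneq u 0%R.
  by rewrite powR0 ?gt_eqF// inve0 gt0_muley ?leey// lte_fin powR_gt0.
have u0' : (0 < u)%R by rewrite lt_neqAle eq_sym un0.
rewrite inver gt_eqF ?powR_gt0// -EFinM lee_fin -powRN -powRM//; last exact: ltW.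
rewrite powRN invf_ge1 ?powR_gt0 ?mulr_gt0// -[leRHS](powRr0 (t * u)).
by rewrite ger_powR ?mulr_gt0 ?(ltW tu)// ltW.
Qed.

End MeasureTheory.

(** * Muckenhoupt weights on a ball *)

Section Muckenhoupt.
Context {d : measure_display} {T : measurableType d} {R : realType}.
Variable mu : {measure set T -> \bar R}.
Implicit Types (w : T -> R) (A B E : set T).

Let conj_weight s w (y : T) : \bar R := (((w y `^ s)%:E)^-1)%E.

Let measurable_conj_weight s w :
  measurable_fun setT w -> measurable_fun setT (conj_weight s w).
Proof.
move=> mw.
have -> : conj_weight s w =
    fun y => if w y `^ s == 0 then +oo%E else (w y `^ (- s))%:E.
  apply/funext => y; rewrite /conj_weight inver; case: ifPn => // _.
  by rewrite powRN.
apply: measurable_fun_ifT => //.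
  by apply: measurable_fun_eqr => //; exact: measurableT_comp (measurable_powR _) mw.
by apply/measurable_EFinP; exact: measurableT_comp (measurable_powR _) mw.
Qed.

(** Integrating the pointwise inequality over [E] with [s = 1/(q-1)] gives
    [mu E <= t w(E) + t^(-s) S], where [S] is the integral of [w^(-s)] over [B]. When [t] makes the
    last term half of [mu E], this bounds [w(E)] from below, and the [A_q] bound eliminates [S]. *)
Lemma Ap_lower_bound w (q K0 M : R) B E :
  (forall x, 0 <= w x) -> measurable_fun setT w -> {ae mu, forall x, 0 < w x} ->
  1 < q -> measurable B -> (0 < mu B)%E -> (mu B < +oo)%E ->
  measurable E -> E `<=` B ->
  (avge mu B (EFin \o w) *
   avge mu B (fun y => ((w y `^ (q - 1)^-1)%:E)^-1) `^ (q - 1) <= K0%:E)%E ->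
  (mu B <= M%:E * mu E)%E ->
  (\int[mu]_(x in B) (w x)%:E < +oo)%E /\
  (\int[mu]_(x in B) (w x)%:E <=
     (K0 * (2 * M) `^ q)%:E * \int[mu]_(x in E) (w x)%:E)%E.
Proof.
move=> w0 mw wae q1 mB B0 Bfin mE EB; rewrite /avge -/(conj_weight _ w) => hA hM.
set s := (q - 1)^-1 in hA.
have s0 : 0 < s by rewrite invr_gt0 subr_gt0.
have mw' : measurable_fun setT (EFin \o w) by exact/measurable_EFinP.
have v0 x : (0 < conj_weight s w x)%E.
  rewrite /conj_weight inver; case: ifPn => // ws0.
  by rewrite lte_fin invr_gt0 lt_neqAle eq_sym ws0 powR_ge0.
have mv : measurable_fun setT (conj_weight s w) by exact: measurable_conj_weight.
have S0 : (0 < \int[mu]_(x in B) conj_weight s w x)%E.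
  apply: integral_gt0 => //; first by move=> x; exact: ltW.
  by apply: aeW.
have W0 : (0 < \int[mu]_(x in B) (EFin \o w) x)%E.
  by apply: integral_gt0 => // x; rewrite lee_fin.
have WEW : (\int[mu]_(x in E) (EFin \o w) x <=
    \int[mu]_(x in B) (EFin \o w) x)%E.
  apply: ge0_subset_integral => //; first exact: measurable_funTS.
  by move=> x _; rewrite lee_fin.
have SES : (\int[mu]_(x in E) conj_weight s w x <=
    \int[mu]_(x in B) conj_weight s w x)%E.
  apply: ge0_subset_integral => //; first exact: measurable_funTS.
  by move=> x _; exact: ltW.
move: hA; set W := (\int[mu]_(x in B) _)%E in W0 WEW *.
set S := (\int[mu]_(x in B) _)%E in S0 SES *.
have [m mE' m0] : exists2 m, mu B = m%:E & 0 < m.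
  exists (fine (mu B)); first by rewrite fineK// ge0_fin_numE.
  by rewrite fine_gt0// B0.
have im0 : (0 < (m%:E)^-1 :> \bar R)%E.
  by rewrite inver gt_eqF// lte_fin invr_gt0.
rewrite mE'.
(* An infinite [W] or [S] would make the [A_q] product infinite, the other factor being positive. *)
case: W W0 WEW => [W W0|_|//] WEW; last first.
  by rewrite gt0_muley// gt0_mulye// poweR_gt0// mule_gt0.
case: S S0 SES => [S S0|_|//] SES; last first.
  rewrite gt0_muley// poweRyr ?gt_eqF ?subr_gt0// gt0_muley ?leye_eq//.
  by rewrite mule_gt0.
rewrite inver gt_eqF// -!EFinM lee_fin => hA.
split; first exact: ltry.
have Efin : (mu E <= m%:E)%E by rewrite -mE'; exact: subset_measure_le.
have [e eE e0] : exists2 e, mu E = e%:E & 0 <= e.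
  exists (fine (mu E)); last exact: fine_ge0.
  by rewrite fineK// ge0_fin_numE// (le_lt_trans Efin)// ltry.
move: hM; rewrite mE' eE -EFinM lee_fin => hM.
have {}e0 : 0 < e.
  rewrite lt_neqAle e0 andbT; apply/eqP => e0'.
  by move: hM; rewrite -e0' mulr0 leNgt m0.
have M0 : 0 < M by rewrite -(pmulr_lgt0 _ e0) (lt_le_trans m0).
(* The solution of [t^(-s) S = mu E / 2]. *)
pose t := (2 * S / e) `^ (q - 1).
have Se0 : 0 < 2 * S / e by rewrite divr_gt0// mulr_gt0.
have t0 : 0 < t by rewrite powR_gt0.
have ts : t `^ (- s) = e / (2 * S).
  rewrite -powRrM mulrN /s mulfV ?gt_eqF ?subr_gt0//.
  by rewrite powR_inv1 ?ltW// invf_div.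
have key : (e%:E <= t%:E * \int[mu]_(x in E) (EFin \o w) x +
    (e / (2 * S))%:E * S%:E)%E.
  apply: (@le_trans _ _ (\int[mu]_(x in E) (t%:E * (EFin \o w) x +
      (t `^ (- s))%:E * conj_weight s w x))%E).
    rewrite -eE -[X in mu X]setIid -(integral_indic mu mE mE).
    apply: ge0_le_integral => //.
    - by apply/measurable_EFinP; exact: measurable_indic.
    - apply: emeasurable_funD; apply: measurable_funTS.
        by apply: measurable_funeM.
      by apply: measurable_funeM.
    - move=> x Ex; rewrite indicE mem_set//.
      exact: one_le_weight_sum.
  rewrite ge0_integralD//; last 4 first.
  - by move=> x _; rewrite mule_ge0// lee_fin// ltW.
  - by apply: measurable_funTS; exact: measurable_funeM.
  - by move=> x _; rewrite mule_ge0 ?lee_fin ?powR_ge0// ltW.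
  - by apply: measurable_funTS; exact: measurable_funeM.
  rewrite ge0_integralZl//; last 3 first.
  - exact: measurable_funTS.
  - by move=> x _; rewrite lee_fin.
  - by rewrite lee_fin ltW.
  rewrite ge0_integralZl//; last 3 first.
  - exact: measurable_funTS.
  - by move=> x _; rewrite ltW.
  - by rewrite lee_fin powR_ge0.
  rewrite ts leeD2l// lee_wpmul2l// lee_fin ltW// divr_gt0// mulr_gt0//.
have WEge0 : (0 <= \int[mu]_(x in E) (EFin \o w) x)%E.
  by apply: integral_ge0 => x _; rewrite lee_fin.
move: key WEW WEge0.
rewrite -[(\int[mu]_(x in E) (w x)%:E)%E]/(\int[mu]_(x in E) (EFin \o w) x)%E.
case: (\int[mu]_(x in E) (EFin \o w) x)%E => [V||]//.
rewrite -!EFinM -EFinD !lee_fin => key _ V0.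
have {}key : e / 2 <= t * V.
  have : e / (2 * S) * S = e / 2 by field; rewrite gt_eqF.
  by move=> h; rewrite h in key; lra.
pose x := 2 * m / e.
have x0 : 0 < x by rewrite divr_gt0// mulr_gt0.
set P := (m^-1 * S) `^ (q - 1) in hA.
have tE : t = x `^ (q - 1) * P.
  have mS0 : 0 <= m^-1 * S by rewrite mulr_ge0 ?invr_ge0// ltW.
  rewrite /t /P -powRM ?(ltW x0)//.
  by congr (_ `^ _); rewrite /x; field; rewrite !gt_eqF.
have P0 : 0 < P by rewrite powR_gt0// mulr_gt0// invr_gt0.
have xq : x * x `^ (q - 1) = x `^ q.
  by rewrite mulr_powRB1 ?(ltW x0)// (lt_trans _ q1).
have h1 : W <= x `^ q * (m^-1 * W * P) * V.
  rewrite -xq -(ler_pM2l (divr_gt0 m0 x0)).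
  have -> : m / x * (x * x `^ (q - 1) * (m^-1 * W * P) * V) = W * (t * V).
    by rewrite tE; field; rewrite !gt_eqF.
  have -> : m / x = e / 2 by rewrite /x; field; rewrite !gt_eqF.
  by rewrite mulrC ler_pM2l.
have hx : x `^ q <= (2 * M) `^ q.
  apply: ge0_ler_powR; rewrite ?nnegrE.
  - by rewrite ltW// (lt_trans _ q1).
  - exact: ltW.
  - by rewrite mulr_ge0// ltW.
  - by rewrite /x -mulrA ler_pM2l// ler_pdivrMr.
apply: (le_trans h1); rewrite [K0 * _]mulrC; apply: ler_wpM2r => //.
apply: ler_pM => //; first exact: powR_ge0.
by rewrite ltW// !mulr_gt0// invr_gt0.
Qed.

End Muckenhoupt.

(** * Sums over geometric levels, and the constants *)

Section Levels.
Context {R : realType}.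
Implicit Types (a b c p q r C D K L M t v : R).

(** The surviving terms have [b^k < t / c], and a geometric sum is at most [b / (b - 1)] times its
    last term. This collects the superlevel sets of the sharp function into the integral of its
    [p]-th power. *)
Lemma sum_geometric_below b c t n : 1 < b -> 0 < c -> 0 <= t ->
  \sum_(k < n) b ^+ k * (c * b ^+ k < t)%R%:R <= t / c * (b / (b - 1)).
Proof.
move=> b1 c0 t0; have b0 : 0 < b by exact: lt_trans b1.
have b10 : 0 < b - 1 by rewrite subr_gt0.
elim: n => [|n IH].
  by rewrite big_ord0 mulr_ge0// ?divr_ge0// ltW.
rewrite big_ord_recr/=; have [cbt|_] := ltP (c * b ^+ n) t; last first.
  by rewrite mulr0 addr0.
apply: (@le_trans _ _ (\sum_(k < n.+1) b ^+ k)).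
  rewrite big_ord_recr/= mulr1 lerD2r; apply: ler_sum => k _.
  by rewrite ler_piMr ?exprn_ge0 ?(ltW b0)// lern1 leq_b1.
have -> : \sum_(k < n.+1) b ^+ k = (b ^+ n.+1 - 1) / (b - 1).
  by rewrite subrX1 mulrC mulKf// gt_eqF.
rewrite mulrA ler_pM2r ?invr_gt0// exprSr.
apply: (@le_trans _ _ (b ^+ n * b)); first by rewrite lerBlDr lerDl.
by rewrite ler_pM2r// ler_pdivlMr// mulrC ltW.
Qed.

(** The recurrence is multiplied by [b^(k+1)] and summed. Partial sums are finite, so the term with
    [b theta] may be moved to the left; this is useful when [b theta < 1]. *)
Lemma sum_linear_recurrence b theta (x y : nat -> R) n :
  0 <= b -> (forall k, 0 <= x k) -> (forall k, x k.+1 <= theta * x k + y k) ->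
  (1 - b * theta) * \sum_(k < n) b ^+ k * x k <=
  x 0%N + b * \sum_(k < n) b ^+ k * y k.
Proof.
move=> b0 x0 xy.
have : \sum_(k < n) b ^+ k * x k <= \sum_(k < n.+1) b ^+ k * x k.
  by rewrite [leRHS]big_ord_recr/= lerDl mulr_ge0// exprn_ge0.
rewrite big_ord_recl/= expr0 mul1r => /le_trans hS.
rewrite mulrBl mul1r lerBlDr; apply: hS.
rewrite -addrA lerD2l !mulr_sumr -big_split/=.
apply: ler_sum => k _; rewrite /bump/= add1n exprS.
rewrite (_ : _ + _ = b * b ^+ k * (theta * x k + y k)); last by ring.
by rewrite ler_wpM2l// mulr_ge0// exprn_ge0.
Qed.

Lemma exists_lt_expr t a : 1 < a -> exists n, t < a ^+ n.
Proof.
move=> a1; have a10 : 0 < a - 1 by rewrite subr_gt0.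
have bernoulli n : 1 + n%:R * (a - 1) <= a ^+ n.
  elim: n => [|n IH]; first by rewrite mul0r addr0 expr0.
  rewrite exprS -natr1; have n0 : 0 <= n%:R :> R by [].
  apply: (@le_trans _ _ (a * (1 + n%:R * (a - 1)))).
    rewrite -subr_ge0 (_ : _ - _ = n%:R * ((a - 1) * (a - 1))); last by ring.
    by rewrite !mulr_ge0// ltW.
  by rewrite ler_wpM2l// ltW// (lt_trans ltr01).
exists (Num.truncn (t / (a - 1))).+1; apply: lt_le_trans (bernoulli _).
rewrite ltr_pwDl// -ler_pdivrMr// ltW//; exact: truncnS_gt.
Qed.

Lemma powR_expn a p k : 0 <= a -> (a ^+ k) `^ p = (a `^ p) ^+ k.
Proof. by move=> a0; rewrite -powR_mulrn// powRAC powR_mulrn// powR_ge0. Qed.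

(** A discrete layer-cake formula: if [v] lies between [L a^k] and [L a^(k+1)], the term of index
    [k] alone is at least [v^p]; the term [L^p] covers [v <= L]. *)
Lemma powR_le_level_sum a p L v (u : nat -> R) n :
  0 < p -> 0 <= a -> 0 <= L -> 0 <= v -> v <= L * a ^+ n ->
  (forall k, 0 <= u k) -> (forall k, L * a ^+ k < v -> 1 <= u k) ->
  v `^ p <= L `^ p + \sum_(k < n) L `^ p * (a `^ p) ^+ k.+1 * u k.
Proof.
move=> p0 a0 L0 v0 + u0 u1; elim: n => [|n IH] vL.
  rewrite big_ord0 addr0; apply: ge0_ler_powR; rewrite ?nnegrE//; first exact: ltW.
  by rewrite expr0 mulr1 in vL.
have S0 k : 0 <= L `^ p * (a `^ p) ^+ k.+1 by rewrite mulr_ge0 ?exprn_ge0// powR_ge0.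
rewrite big_ord_recr/= addrA.
have [/IH h|Lv] := leP v (L * a ^+ n).
  by apply: (le_trans h); rewrite lerDl mulr_ge0.
apply: (@le_trans _ _ (L `^ p * (a `^ p) ^+ n.+1)).
  rewrite -powR_expn// -powRM ?exprn_ge0//.
  by apply: ge0_ler_powR; rewrite ?nnegrE ?mulr_ge0 ?exprn_ge0// ltW.
rewrite -[leLHS]add0r; apply: lerD; last by rewrite ler_peMr// u1.
by rewrite addr_ge0 ?powR_ge0// sumr_ge0// => k _; rewrite mulr_ge0.
Qed.

(* With [C] the constant of [cube_weight_half] and [D] that of
   [mu_ball_le_cube], [b = a^p] satisfies [b (1 - 1/C) < 1], and [gam] is such
   that [a = 1 + 2 D gam] in [good_lambda]. *)
Definition local_constant C D r : R :=
  let b := 2 * C / (2 * C - 1) in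
  let gam := (b `^ r^-1 - 1) / (2 * D) in
  1 + b * (2 * C - 1) + b ^+ 3 * (2 * C - 1) / ((b - 1) * gam `^ r).

(** [C'] is the constant of [cube_weight_le] for [M = 16]. In [oscillation_estimate], [16^r + 1]
    multiplies the sharp term and [2^r C'] the integral over [E]; the sum dominates both. *)
Definition oscillation_constant C C' D r : R :=
  local_constant C D r * (16 `^ r + 2 `^ r * C' + 1).

Lemma local_constant_ge0 C D r : 1 <= C -> 1 <= D -> 0 < r ->
  0 <= local_constant C D r.
Proof.
move=> C1 D1 r0; rewrite /local_constant; set b := _ / (2 * C - 1).
have C2 : 0 < 2 * C - 1 by lra.
have b1 : 1 < b by rewrite ltr_pdivlMr//; lra.
have b0 : 0 <= b by lra.
have ? : 0 <= b * (2 * C - 1) by rewrite mulr_ge0// ltW.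
apply: addr_ge0; first by lra.
apply: divr_ge0; first by rewrite mulr_ge0 ?exprn_ge0// ltW.
by rewrite mulr_ge0 ?powR_ge0//; lra.
Qed.

Lemma scaled_powR_ge1 K q D M : 1 <= K -> 0 <= q -> 1 <= D -> 1 <= M ->
  1 <= K * (2 * (D * M)) `^ q.
Proof.
move=> K1 q0 D1 M1; rewrite -[leLHS]mulr1; apply: ler_pM => //.
rewrite -[leLHS](powRr0 (2 * (D * M))); apply: ler_powR => //; nra.
Qed.

End Levels.

(** * Dyadic cubes *)

Lemma subz_succ (n : int) (k : nat) : n - k.+1%:Z = n - k%:Z - 1.
Proof. by rewrite -addn1 PoszD opprD addrA. Qed.

(* A cube of level [n] contains a ball [B_(eps0 delta^n)(z)]; with [k] the
   exponent below, [B_(2^k eps0 delta^n)(z)] contains the balls of radius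
   [(|N0| + 1) delta^(n-1)] centered in the cube. *)
Definition cube_doubling {R : realType} (K1 K2 delta eps0 N0 : R) : R :=
  Num.max 1 K2 ^+
    (Num.truncn (2 * (`|K1| + 1) * (`|N0| + 1) / (delta * eps0))).+1.

Lemma cube_doubling_ge1 {R : realType} (K1 K2 delta eps0 N0 : R) :
  1 <= cube_doubling K1 K2 delta eps0 N0.
Proof. by rewrite exprn_ege1// le_max lexx. Qed.

Definition cube {X : Type} (I : int -> Type) (Q : forall n, I n -> set X)
  (n : int) : set (set X) := range (Q n).

Section Cubes.
Context {d : measure_display} {X : measurableType d} {R : realType}.
Variables (mu : {measure set X -> \bar R}) (rho : X -> X -> R).
Variables (K1 K2 delta eps0 N0 : R).
Variables (I : int -> Type) (Q : forall n, I n -> set X).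
Hypothesis hom : homogeneous_space K1 K2 rho mu.
Hypothesis dya : dyadic_filtration delta eps0 N0 rho mu Q.
Hypotheses (hdelta : 0 < delta < 1) (heps0 : 0 < eps0).

Local Notation ball := (qball rho).
Local Notation CD := (cube_doubling K1 K2 delta eps0 N0).
Local Notation cube := (cube Q).

Let CD_ge1 : 1 <= CD.
Proof. exact: cube_doubling_ge1. Qed.

Let rho0 x y : 0 <= rho x y.
Proof. exact: quasi_metric_ge0 (homogeneous_metric hom) x y. Qed.

Let rhoC x y : rho x y = rho y x.
Proof. exact: quasi_metric_sym (homogeneous_metric hom) x y. Qed.

Lemma rho_self x : rho x x = 0.
Proof. exact/(quasi_metric_eq0 (homogeneous_metric hom)). Qed.

(** The constant [|K1| + 1] is at least [1] whatever the sign of [K1]. *)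
Lemma rho_triangle x y z : rho x y <= (`|K1| + 1) * (rho x z + rho z y).
Proof.
apply: le_trans (quasi_metric_triangle (homogeneous_metric hom) x y z) _.
by rewrite ler_wpM2r ?addr_ge0// (le_trans (ler_norm _))// lerDl.
Qed.

Lemma measurable_ball x r : 0 < r -> measurable (ball x r).
Proof.
move=> r0; apply: (homogeneous_measurable hom).
exact: homogeneous_ball_open hom _ _ r0.
Qed.

Lemma ball_gt0 x r : 0 < r -> (0 < mu (ball x r))%E.
Proof.
move=> r0; have /(homogeneous_ball_gt0 hom x) : 0 < r / 2 by rewrite divr_gt0.
by rewrite mulrC divfK.
Qed.

Lemma doubling x r : 0 < r -> (mu (ball x (2 * r)) <= K2%:E * mu (ball x r))%E.
Proof. exact: homogeneous_doubling hom x r. Qed.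

Lemma K2_gt0 : 0 < K2.
Proof.
have x : X by exact: point.
have B1 : (0 < mu (ball x 1))%E by exact: ball_gt0.
have := lt_le_trans (ball_gt0 x (_ : 0 < 2 * 1)) (doubling x ltr01).
by rewrite mulr1 => /(_ (ltr0n R 2)); rewrite pmule_lgt0.
Qed.

Lemma ball_lty x r : 0 < r -> (mu (ball x r) < +oo)%E.
Proof.
move=> r0; have := homogeneous_ball_fin hom x r0.
have [->|] := eqVneq (mu (ball x r)) +oo%E; last by rewrite -ltey => ->.
by rewrite gt0_muley// lte_fin K2_gt0.
Qed.

Lemma ball_sub x r s : r <= s -> ball x r `<=` ball x s.
Proof. by move=> rs y /lt_le_trans; apply. Qed.

Lemma iter_doubling x r k : 0 < r ->
  (mu (ball x (2 ^+ k * r)) <= (Num.max 1 K2 ^+ k)%:E * mu (ball x r))%E.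
Proof.
move=> r0; elim: k => [|k IH]; first by rewrite !expr0 mul1r mul1e.
have r0' : 0 < 2 ^+ k * r by rewrite mulr_gt0// exprn_gt0.
rewrite exprS -mulrA; apply: le_trans (doubling x r0') _.
apply: (@le_trans _ _ ((Num.max 1 K2)%:E * mu (ball x (2 ^+ k * r)))%E).
  by rewrite lee_wpmul2r// lee_fin le_max lexx orbT.
rewrite [in leRHS]exprS EFinM -muleA lee_wpmul2l// lee_fin.
by rewrite le_max ler01.
Qed.

Lemma delta_gt0 : 0 < delta. Proof. by case/andP: hdelta. Qed.

Lemma delta_expz n : delta ^ n = delta * delta ^ (n - 1).
Proof.
rewrite expfzDr ?gt_eqF ?delta_gt0// mulrCA exprN1 mulfV ?mulr1//.
by rewrite gt_eqF// delta_gt0.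
Qed.

Lemma delta_exp_le n : delta ^ n <= delta ^ (n - 1).
Proof.
rewrite delta_expz ler_piMl ?exprz_ge0 ?(ltW delta_gt0)//.
by case/andP: hdelta => _ /ltW.
Qed.

Lemma cube_radius_gt0 n : 0 < (`|N0| + 1) * delta ^ n.
Proof. by rewrite mulr_gt0// ?exprz_gt0 ?delta_gt0// ltr_wpDl. Qed.

Lemma cube_measurable n A : cube n A -> measurable A.
Proof.
move=> [a _ <-]; apply: (homogeneous_measurable hom).
exact: dyadic_open dya _ _.
Qed.

Lemma cube_sub_ball n A x : cube n A -> A x ->
  A `<=` ball x ((`|N0| + 1) * delta ^ n).
Proof.
move=> [a _ <-] Qx y Qy; rewrite /qball/=.
have : ((rho x y)%:E <= qdiam rho (Q a))%E.
  by apply: ereal_sup_ubound; exists (x, y).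
move=> /le_trans/(_ (dyadic_diam dya a)); rewrite lee_fin => /le_lt_trans; apply.
rewrite ltr_pM2r ?exprz_gt0 ?delta_gt0//.
by rewrite (le_lt_trans (ler_norm _))// ltrDl.
Qed.

Lemma cube_center n A : cube n A ->
  exists2 z, A z & ball z (eps0 * delta ^ n) `<=` A.
Proof.
move=> [a _ <-]; have [z zA] := dyadic_ball dya a; exists z => //.
by apply: zA; rewrite /qball/= rho_self mulr_gt0// exprz_gt0// delta_gt0.
Qed.

Lemma cube_gt0 n A : cube n A -> (0 < mu A)%E.
Proof.
move=> nA; have [z _ zA] := cube_center nA.
have r0 : 0 < eps0 * delta ^ n by rewrite mulr_gt0// exprz_gt0// delta_gt0.
apply: lt_le_trans (ball_gt0 z r0) _; apply: subset_measure_le => //.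
  exact: measurable_ball.
exact: cube_measurable nA.
Qed.

Lemma cube_lty n A : cube n A -> (mu A < +oo)%E.
Proof.
move=> nA; have [z Az _] := cube_center nA.
apply: le_lt_trans (ball_lty z (cube_radius_gt0 n)).
apply: subset_measure_le; last exact: cube_sub_ball nA Az.
  exact: cube_measurable nA.
exact/measurable_ball/cube_radius_gt0.
Qed.

Lemma cube_fin_num n A : cube n A -> mu A \is a fin_num.
Proof. by move=> nA; rewrite ge0_fin_numE// (cube_lty nA). Qed.

Lemma cube_sub_parent_ball n A x : cube n A -> A x ->
  A `<=` ball x ((`|N0| + 1) * delta ^ (n - 1)).
Proof.
move=> nA Ax; apply: subset_trans (cube_sub_ball nA Ax) _; apply: ball_sub.
by rewrite ler_wpM2l ?delta_exp_le// addr_ge0.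
Qed.

(** The ball has the radius of level [n - 1], so it also contains the parent of [A]: the same bound
    compares a cube with its parent in [cube_parent_le]. *)
Lemma mu_ball_le_cube n A x : cube n A -> A x ->
  (mu (ball x ((`|N0| + 1) * delta ^ (n - 1))) <= CD%:E * mu A)%E.
Proof.
move=> nA Ax; have [z Az zA] := cube_center nA.
have e0 : 0 < eps0 * delta ^ n by rewrite mulr_gt0// exprz_gt0// delta_gt0.
set r := (`|N0| + 1) * _; have r0 : 0 < r by exact: cube_radius_gt0.
rewrite /cube_doubling; set t := _ / _.
set k := (Num.truncn t).+1.
have tk : t <= 2 ^+ k.
  apply: (@le_trans _ _ k%:R); first exact/ltW/truncnS_gt.
  by rewrite -natrX ler_nat ltnW// ltn_expl.
apply: (@le_trans _ _ (mu (ball z (2 ^+ k * (eps0 * delta ^ n))))).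
  apply: subset_measure_le; [exact: measurable_ball| |].
    by apply: measurable_ball; rewrite mulr_gt0// exprn_gt0.
  move=> y; rewrite /qball/= => xy.
  have zx : rho z x < r by exact: cube_sub_parent_ball nA Az _ Ax.
  apply: (@lt_le_trans _ _ (t * (eps0 * delta ^ n))); last by rewrite ler_pM2r.
  have -> : t * (eps0 * delta ^ n) = (`|K1| + 1) * (r + r).
    rewrite /t /r delta_expz; field.
    by rewrite !gt_eqF// delta_gt0.
  apply: le_lt_trans (rho_triangle z y x) _.
  by rewrite ltr_pM2l ?ltrD// ltr_wpDl.
apply: le_trans (iter_doubling z k e0) _.
rewrite lee_wpmul2l// ?lee_fin ?exprn_ge0 ?le_max ?ler01//.
apply: subset_measure_le => //; first exact: measurable_ball.
exact: cube_measurable nA.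
Qed.

Lemma cube_disjoint n A B x : cube n A -> cube n B -> A x -> B x -> A = B.
Proof.
move=> [a _ <-] [b _ <-] Ax Bx; congr (Q _).
by apply: (dyadic_disjoint dya) => //; exists x.
Qed.

Lemma cube_parent n A : cube n A -> exists2 P, cube (n - 1) P & A `<=` P.
Proof.
move=> [a _ <-]; have [b [ab _]] := dyadic_nested dya a.
by exists (Q b) => //; exists b.
Qed.

Lemma cube_ancestor n A k : cube n A -> exists2 P, cube (n - k%:Z) P & A `<=` P.
Proof.
move=> nA; elim: k => [|k [P nP AP]]; first by exists A; rewrite ?subr0.
have [P' nP' PP'] := cube_parent nP.
exists P'; last exact: subset_trans AP PP'.
by rewrite -addn1 PoszD opprD addrA.
Qed.

Lemma cube_nested n k A B x : cube n A -> cube (n + k%:Z) B -> A x -> B x ->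
  B `<=` A.
Proof.
move=> nA nB Ax Bx; have [P] := cube_ancestor k nB.
rewrite addrK => nP BP; rewrite (cube_disjoint nA nP Ax)//.
exact: BP.
Qed.

Lemma cube_trivIset n : trivIset (cube n) id.
Proof. by move=> A B nA nB [x [Ax Bx]]; exact: cube_disjoint nA nB Ax Bx. Qed.

Lemma countable_cube n : countable (cube n).
Proof.
have x0 : X by exact: point.
pose B k := ball x0 k.+1%:R.
have -> : cube n = \bigcup_k (cube n `&` [set A | (0 < mu (A `&` B k))%E]).
  apply/seteqP; split=> [A nA|A [k _ []]//].
  have [z Az zA] := cube_center nA; set r := eps0 * _ in zA.
  have r0 : 0 < r by rewrite mulr_gt0// exprz_gt0// delta_gt0.
  (* With this [k], [B k] contains the ball inscribed in [A], hence meets [A] in positive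
     measure. *)
  exists (Num.truncn ((`|K1| + 1) * (rho x0 z + r))) => //; split=> //=.
  apply: lt_le_trans (ball_gt0 z r0) _; apply: subset_measure_le.
  - exact: measurable_ball.
  - by apply: measurableI; [exact: cube_measurable nA|exact: measurable_ball].
  - move=> y zy; split; first exact: zA.
    apply: le_lt_trans (truncnS_gt _).
    apply: le_trans (rho_triangle x0 y z) _.
    by rewrite ler_wpM2l ?addr_ge0// lerD2l ltW.
apply: bigcup_countable => // k _.
apply: (@countable_disjoint_gt0 _ _ _ mu _ (B k)).
- exact: measurable_ball.
- exact: ball_lty.
- by apply: sub_trivIset (@cube_trivIset n) => A [].
- by move=> A [nA A0]; split=> //; exact: cube_measurable nA.
Qed.

(** Any union of cubes is open, so measurability requires no counting. *)
Lemma measurable_bigcup_cubes (P : set (set X)) :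
  (forall A, P A -> exists n, cube n A) -> measurable (\bigcup_(A in P) A).
Proof.
move=> Pcube; apply: (homogeneous_measurable hom) => x [A PA Ax].
have [n [a _ aA]] := Pcube A PA; rewrite -aA in Ax.
have [r r0 rA] := dyadic_open dya Ax.
by exists r => // y /rA Ay; exists A => //; rewrite -aA.
Qed.

Lemma bigcup_cube n : \bigcup_a @Q n a = \bigcup_(A in cube n) A.
Proof. by rewrite bigcup_image. Qed.

Lemma measurable_bigcup_cube n : measurable (\bigcup_(A in cube n) A).
Proof. by apply: measurable_bigcup_cubes => A nA; exists n. Qed.

(** A cube lies in an ancestor at every coarser level, so the nonnegative levels determine the core,
    and a countable intersection indexed by [nat] is enough. *)
Lemma dyadic_coreE :
  dyadic_core Q = \bigcap_(k : nat) \bigcup_(A in cube k%:Z) A.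
Proof.
rewrite /dyadic_core; under eq_bigcapr do rewrite bigcup_cube.
apply/seteqP; split=> [x Hx k _|x Hx n _]; first exact: Hx.
have [A nA Ax] := Hx `|n|%N Logic.I.
have [P] := cube_ancestor (absz (`|n|%:Z - n)) nA.
rewrite (_ : _ - _ = n); last by lia.
move=> nP AP.
by exists P => //; exact: AP.
Qed.

Lemma measurable_core : measurable (dyadic_core Q).
Proof.
rewrite dyadic_coreE; apply: bigcapT_measurable => k.
exact: measurable_bigcup_cube.
Qed.

Lemma mu_coreC : mu (~` dyadic_core Q) = 0%E.
Proof.
rewrite dyadic_coreE setC_bigcap.
apply/negligibleP.
  apply: bigcup_measurable => k _; apply: measurableC.
  exact: measurable_bigcup_cube.
apply: negligible_bigcup => k.
apply/negligibleP; first exact/measurableC/measurable_bigcup_cube.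
by rewrite -bigcup_cube; exact: dyadic_full dya _.
Qed.

Lemma ae_core : {ae mu, forall x, dyadic_core Q x}.
Proof.
exists (~` dyadic_core Q); split=> //; first exact/measurableC/measurable_core.
exact: mu_coreC.
Qed.

Lemma core_cube x n : dyadic_core Q x -> exists2 A, cube n A & A x.
Proof. by move=> /(_ n Logic.I); rewrite bigcup_cube => -[A nA Ax]; exists A. Qed.

(* The level [k] is recorded because one set may be a cube of several levels. *)
Definition stopping n0 (P : set (set X)) : set (set X) :=
  [set A | P A /\ exists2 k : nat, cube (n0 + k%:Z) A &
    forall j B, (j < k)%N -> cube (n0 + j%:Z) B -> A `<=` B -> ~ P B].

(** The levels occurring in [P] start at [n0], so among the members of [P] that contain a given one
    there is one of least level, and it is a stopping cube. *)
Lemma bigcup_stopping n0 P :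
  (forall A, P A -> exists k : nat, cube (n0 + k%:Z) A) ->
  \bigcup_(A in stopping n0 P) A = \bigcup_(A in P) A.
Proof.
move=> Plev; apply/seteqP; split=> [x [A [PA _] Ax]|x [A PA Ax]].
  by exists A.
pose S k := `[< exists B, [/\ P B, cube (n0 + k%:Z) B & A `<=` B] >].
have exS : exists k, S k.
  by have [k nA] := Plev _ PA; exists k; apply/asboolP; exists A; split => // ?.
case: (ex_minnP exS) => k /asboolP[B [PB nB AB]] kmin.
exists B; last exact: AB.
split=> //; exists k => // j C jk nC BC PC.
have : (k <= j)%N.
  apply: kmin; apply/asboolP; exists C; split=> //; exact: subset_trans BC.
by rewrite leqNgt jk.
Qed.

(** Of two cubes that meet, the finer lies in the coarser, which contradicts the minimality of its
    level unless both levels agree. *)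
Lemma stopping_trivIset n0 P : trivIset (stopping n0 P) id.
Proof.
suff wlg A B x k l : P A -> P B -> cube (n0 + k%:Z) A -> cube (n0 + l%:Z) B ->
    (forall j C, (j < l)%N -> cube (n0 + j%:Z) C -> B `<=` C -> ~ P C) ->
    A x -> B x -> (k <= l)%N -> A = B.
  move=> A B [PA [k nA kmin]] [PB [l nB lmin]] [x [Ax Bx]].
  have [kl|/ltnW lk] := leqP k l; first
    exact: (wlg A B x k l PA PB nA nB lmin Ax Bx kl).
  by apply/esym; exact: (wlg B A x l k PB PA nB nA kmin Bx Ax lk).
move=> PA PB nA nB lmin Ax Bx; rewrite leq_eqVlt => /orP[/eqP kl|kl].
  by rewrite kl in nA; exact: cube_disjoint nA nB Ax Bx.
suff BA : B `<=` A by have := lmin _ _ kl nA BA.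
apply: (@cube_nested _ (l - k)%N _ _ x nA _ Ax Bx).
by rewrite -addrA -PoszD subnKC// ltnW.
Qed.

Lemma countable_stopping n0 P : countable (stopping n0 P).
Proof.
apply: (@sub_countable _ _ _ (\bigcup_(k : nat) cube (n0 + k%:Z))).
  by apply: subset_card_le => A [_ [k nA _]]; exists k.
by apply: bigcup_countable => // k _; exact: countable_cube.
Qed.

Lemma le_integral_stopping n0 P (g h : X -> \bar R) :
  (forall A, P A -> exists k : nat, cube (n0 + k%:Z) A) ->
  measurable_fun setT g -> measurable_fun setT h ->
  (forall x, 0 <= g x)%E -> (forall x, 0 <= h x)%E ->
  (forall A, stopping n0 P A ->
    \int[mu]_(x in A) g x <= \int[mu]_(x in A) h x)%E ->
  (\int[mu]_(x in \bigcup_(A in P) A) g x <=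
   \int[mu]_(x in \bigcup_(A in P) A) h x)%E.
Proof.
move=> Plev mg mh g0 h0 gh; rewrite -(bigcup_stopping Plev).
apply: le_integral_disjoint_cover => //.
- exact: countable_stopping.
- by move=> A [_ [k /cube_measurable]].
- exact: stopping_trivIset.
Qed.

(** * Good-lambda inequality *)

Section Weight.
Variables (q K0 : R) (w : X -> R).
Hypotheses (hq : 1 < q) (hK0 : 1 <= K0).
Hypotheses (hw : Ap_weight mu rho q w)
  (hA : (Ap_constant mu rho q w <= K0%:E)%E).

Local Notation om := (weight_measure mu w).
Local Notation CW M := (K0 * (2 * (CD * M)) `^ q).

Lemma weight_ge0 x : 0 <= w x.
Proof. exact: Ap_ge0 hw x. Qed.

Lemma measurable_weight : measurable_fun setT (EFin \o w).
Proof. exact/measurable_EFinP/(Ap_measurable hw). Qed.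

Local Hint Resolve measurable_weight weight_ge0 : core.

Lemma om_ge0 A : (0 <= om A)%E.
Proof. by apply: integral_ge0 => x _; rewrite lee_fin. Qed.

Lemma om_le A B : measurable A -> measurable B -> A `<=` B -> (om A <= om B)%E.
Proof.
move=> mA mB AB; apply: ge0_subset_integral => //.
  by apply: measurable_funTS; exact: measurable_weight.
by move=> x _; rewrite lee_fin.
Qed.

Lemma om_setU A B : measurable A -> measurable B -> [disjoint A & B] ->
  om (A `|` B) = (om A + om B)%E.
Proof.
move=> mA mB AB; apply: ge0_integral_setU => //.
  by apply: measurable_funTS; exact: measurable_weight.
by move=> x _; rewrite lee_fin.
Qed.

Lemma om_splitD A B : measurable A -> measurable B ->
  om A = (om (A `&` B) + om (A `\` B))%E.
Proof.
move=> mA mB; rewrite -om_setU; first by rewrite setUIDK.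
- exact: measurableI.
- exact: measurableD.
- by rewrite disj_set2E; apply/eqP; rewrite setDE setIACA setICr setI0.
Qed.

Lemma om_null A : measurable A -> mu A = 0%E -> om A = 0%E.
Proof.
move=> mA A0; rewrite -(integral_abs_eq0 mA (_ : measurable_fun A (EFin \o w)) A0).
- by apply: eq_integral => x _; rewrite /= ger0_norm.
- by apply: measurable_funTS; exact: measurable_weight.
Qed.

(** The [A_q] bound is applied to the ball of level [n - 1] around [A], whose measure is at most
    [CD mu A <= CD M mu E]; this is why [CW M] contains the product [CD * M]. *)
Lemma cube_weight_le n A E M : cube n A -> measurable E -> E `<=` A ->
  (mu A <= M%:E * mu E)%E ->
  (om A < +oo)%E /\ (om A <= (CW M)%:E * om E)%E.
Proof.
move=> nA mE EA hM; have [z Az _] := cube_center nA.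
have mB := measurable_ball z (cube_radius_gt0 (n - 1)).
have AB := cube_sub_parent_ball nA Az.
have [||Wfin Wle] := @Ap_lower_bound _ _ _ mu w q K0 (CD * M) _ E weight_ge0
  (Ap_measurable hw) (Ap_ae_gt0 hw) hq mB (ball_gt0 z (cube_radius_gt0 _))
  (ball_lty z (cube_radius_gt0 _)) mE (subset_trans EA AB).
- apply: le_trans hA; apply: ereal_sup_ubound.
  by exists z, ((`|N0| + 1) * delta ^ (n - 1)); split=> //; exact: cube_radius_gt0.
- apply: le_trans (mu_ball_le_cube nA Az) _.
  rewrite EFinM -muleA lee_wpmul2l// lee_fin.
  exact: le_trans ler01 CD_ge1.
- have AleB : (om A <= om (ball z ((`|N0| + 1) * delta ^ (n - 1))))%E.
    by apply: om_le => //; exact: cube_measurable nA.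
  by split; [exact: le_lt_trans AleB Wfin|exact: le_trans AleB Wle].
Qed.

Lemma cube_om_lty n A : cube n A -> (om A < +oo)%E.
Proof.
move=> nA; have [||//] := @cube_weight_le n A A 1 nA (cube_measurable nA).
  by [].
by rewrite mul1e.
Qed.

Lemma CW_ge1 M : 1 <= M -> 1 <= CW M.
Proof.
by apply: scaled_powR_ge1 => //; rewrite ltW// (lt_trans ltr01).
Qed.

Lemma cube_weight_half n A E : cube n A -> measurable E -> E `<=` A ->
  (2%:E * mu E <= mu A)%E -> (om E <= (1 - (CW 2)^-1)%:E * om A)%E.
Proof.
move=> nA mE EA hE; have mA := cube_measurable nA.
have mAE : measurable (A `\` E) by exact: measurableD.
have Afin := cube_fin_num nA.
have muD : mu A = (mu E + mu (A `\` E))%E.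
  rewrite -measureU//; first by rewrite setDUK.
  by rewrite setDIK.
have [||_] := @cube_weight_le n A (A `\` E) 2 nA mAE.
- by move=> x [].
- move: hE Afin; rewrite muD fin_numD => + /andP[].
  move: (mu E) (mu (A `\` E)) => [e| |] [b| |]//.
  by rewrite -!EFinM -!EFinD !lee_fin => h _ _; lra.
have := cube_om_lty nA.
have -> : om A = (om E + om (A `\` E))%E.
  rewrite -om_setU//; first by rewrite setDUK.
  by rewrite disj_set2E setDIK.
have := om_ge0 E; have := om_ge0 (A `\` E).
move: (om E) (om (A `\` E)) => [e| |] [b| |]//.
rewrite -!EFinD -!EFinM !lee_fin => b0 e0 _ h.
have C1 : 1 <= CW 2 by rewrite CW_ge1// ler1n.
set C := CW 2 in h C1 *.
have C0 : 0 < C by exact: lt_le_trans C1.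
have : (e + b) / C <= b by rewrite ler_pdivrMr// mulrC.
rewrite mulrBl mul1r [C^-1 * _]mulrC; lra.
Qed.

Section Function.
Variable f : X -> R.
Hypotheses (mf : measurable_fun setT f) (locf : loc_integrable mu rho f).

Local Notation sharp := (dyadic_sharp mu Q f).
Local Notation Iabs A := (\int[mu]_(y in A) `|f y|%:E)%E.

Let mabsB c : measurable_fun setT (fun y => `|f y - c|%:E).
Proof.
apply/measurable_EFinP; apply: measurableT_comp => //.
by apply: measurable_funB => //; exact: measurable_cst.
Qed.

Let mabs : measurable_fun setT (fun y => `|f y|%:E).
Proof. by apply/measurable_EFinP; exact: measurableT_comp. Qed.

Lemma cube_integrable n A : cube n A -> mu.-integrable A (EFin \o f).
Proof.
move=> nA; have [z Az _] := cube_center nA.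
apply: integrableS (cube_sub_ball nA Az) (locf z (cube_radius_gt0 n)).
  exact/measurable_ball/cube_radius_gt0.
exact: cube_measurable nA.
Qed.

Lemma cube_Iabs_fin n A : cube n A -> Iabs A \is a fin_num.
Proof.
move=> nA; rewrite ge0_fin_numE; last by apply: integral_ge0 => x _; rewrite lee_fin.
by have /integrableP[_] := cube_integrable nA.
Qed.

Lemma normr_avg_le n A : cube n A -> (`|avg mu A f|%:E * mu A <= Iabs A)%E.
Proof.
move=> nA; have mA := cube_measurable nA.
have mfE : measurable_fun A (EFin \o f).
  by apply: measurable_funTS; exact/measurable_EFinP.
have := le_abse_integral mu mA mfE; have := integrable_fin_num mA (cube_integrable nA).
rewrite /avg /avge; have := cube_gt0 nA; have := cube_fin_num nA.
case: (mu A) => [m _| |]//; rewrite lte_fin => m0.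
rewrite inver gt_eqF//.
case: (integral mu A (EFin \o f)) => [j _ jI| |]//; apply: le_trans jI.
rewrite /= -EFinM lee_fin normrM gtr0_norm ?invr_gt0//.
by rewrite mulrAC mulVf ?gt_eqF// mul1r.
Qed.

Lemma integral_sub_avg_le n A x : cube n A -> dyadic_core Q x -> A x ->
  (\int[mu]_(y in A) `|f y - avg mu A f|%:E <= sharp x * mu A)%E.
Proof.
move=> nA cx Ax.
have : (avge mu A (fun y => `|f y - avg mu A f|%:E) <= sharp x)%E.
  rewrite /dyadic_sharp /patch mem_set//; apply: ereal_sup_ubound.
  by move: nA => [a _ <-] in Ax *; exists n, a.
have : (0 <= \int[mu]_(y in A) `|f y - avg mu A f|%:E)%E.
  by apply: integral_ge0 => y _; rewrite lee_fin.
rewrite /avge; move: (integral _ _ _) => J J0.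
have := cube_gt0 nA; have := cube_fin_num nA.
case: (mu A) => [m _ m0| |]//; rewrite lte_fin in m0.
rewrite inver gt_eqF// => /(lee_wpmul2r (_ : 0 <= m%:E)%E); rewrite lee_fin ltW//.
by move=> /(_ isT); rewrite muleAC -EFinM mulVf ?gt_eqF// mul1e.
Qed.

Lemma sharp_ge0 x : (0 <= sharp x)%E.
Proof.
rewrite /dyadic_sharp /patch; case: ifPn => // /set_mem cx.
have [a _ ax] := cx 0 Logic.I.
apply: le_trans (ereal_sup_ubound _); last by exists 0, a; split.
by rewrite /avge mule_ge0 ?inve_ge0// integral_ge0// => y _; rewrite lee_fin.
Qed.

(** For [r >= 0] the set where [sharp > r] is the trace on the core of a union of cubes, namely
    those whose own mean oscillation exceeds [r]. For [r < 0] it is everything. *)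
Lemma measurable_sharp : measurable_fun setT sharp.
Proof.
move=> _; apply: (measurability _ (ErealGenOInfty.measurableE R)) => //.
move=> _ [_ [r ->] <-]; rewrite setTI.
have [r0|r0] := ltP r 0.
  rewrite (_ : _ @^-1` _ = setT)//; apply/seteqP; split=> // x _ /=.
  by rewrite in_itv/= andbT (lt_le_trans _ (sharp_ge0 x))// lte_fin.
pose P := [set A | exists n (a : I n), A = Q a /\
  (r%:E < avge mu (Q a) (fun y => `|f y - avg mu (Q a) f|%:E))%E].
rewrite (_ : _ @^-1` _ = dyadic_core Q `&` \bigcup_(A in P) A).
  apply: measurableI; first exact: measurable_core.
  by apply: measurable_bigcup_cubes => _ [n [a [-> _]]]; exists n, a.
apply/seteqP; split=> x /=; rewrite in_itv/= andbT /dyadic_sharp /patch.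
  case: ifPn => [/set_mem cx|_]; last by rewrite lte_fin ltNge r0.
  move=> /ereal_sup_gt[_ [n [a [ax ->]]] rs]; split=> //.
  by exists (Q a) => //; exists n, a.
move=> [cx [_ [n [a [-> ra]]] ax]]; rewrite mem_set//.
by apply: lt_le_trans ra _; apply: ereal_sup_ubound; exists n, a.
Qed.

Lemma cube_parent_le n A P : cube n A -> cube (n - 1) P -> A `<=` P ->
  (mu P <= CD%:E * mu A)%E.
Proof.
move=> nA nP AP; have [z Az _] := cube_center nA.
apply: le_trans (mu_ball_le_cube nA Az); apply: subset_measure_le.
- exact: cube_measurable nP.
- exact/measurable_ball/cube_radius_gt0.
- by apply: cube_sub_ball nP _; exact: AP.
Qed.

Lemma integral_abs_sub_le n A c : cube n A ->
  (Iabs A <= \int[mu]_(y in A) `|f y - c|%:E + `|c|%:E * mu A)%E.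
Proof.
move=> nA; have mA := cube_measurable nA.
rewrite -(integral_cst mu mA) -ge0_integralD//; last 2 first.
- exact: measurable_funTS.
- by move=> y _; rewrite lee_fin.
apply: ge0_le_integral => //.
- exact: measurable_funTS.
- apply: emeasurable_funD; [exact: measurable_funTS|exact: measurable_cst].
- by move=> x _; rewrite -EFinD lee_fin -{1}(subrK c (f x)) ler_normD.
Qed.

(** The union of these cubes is the superlevel set, at height [lam], of the dyadic maximal function
    of [f] localized to [Q0]. *)
Definition heavy n0 Q0 (lam : R) : set (set X) :=
  [set A | [/\ A `<=` Q0, exists k : nat, cube (n0 + k%:Z) A
    & (lam%:E * mu A < Iabs A)%E]].

Lemma measurable_heavy n0 Q0 lam : measurable (\bigcup_(A in heavy n0 Q0 lam) A).
Proof. by apply: measurable_bigcup_cubes => A [_ [k kA] _]; eexists; exact: kA. Qed.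

Lemma heavy_sub n0 Q0 lam : \bigcup_(A in heavy n0 Q0 lam) A `<=` Q0.
Proof. by move=> x [A [AQ _ _] /AQ]. Qed.

Lemma heavy_mono n0 Q0 lam lam' : lam <= lam' ->
  heavy n0 Q0 lam' `<=` heavy n0 Q0 lam.
Proof.
move=> ll A [AQ kA lA]; split=> //; apply: le_lt_trans lA.
by rewrite lee_wpmul2r// lee_fin.
Qed.

(* Let [c] be the mean of [f] over the parent of [A]; then [|c| <= lam]. A cube
   in [A] over which [|f|] has mean more than [a lam] has [|f - c|]-mean more
   than [(a - 1) lam], while the [|f - c|]-mean over the parent is at most
   [sharp x <= gam lam], so the bound is a weak-type (1, 1) estimate. *)
Lemma stopping_heavy_half n0 Q0 lam gam A x :
  cube n0 Q0 -> 0 < lam -> 0 < gam -> (Iabs Q0 <= lam%:E * mu Q0)%E ->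
  stopping n0 (heavy n0 Q0 lam) A -> A x -> dyadic_core Q x ->
  (sharp x <= (gam * lam)%:E)%E ->
  (2%:E * mu (A `&` \bigcup_(B in heavy n0 Q0 ((1 + 2 * CD * gam) * lam)) B)
    <= mu A)%E.
Proof.
move=> nQ0 lam0 gam0 IQ0 [[AQ0 _ lamA] [k nA kmin]] Ax cx sx.
have C1 := CD_ge1.
set a := 1 + _.
have a1 : 1 < a by rewrite /a ltrDl !mulr_gt0// (lt_le_trans ltr01).
(* At [k = 0] the cube would be [Q0], whose mean is at most [lam]. So [A] has a parent inside [Q0],
   and that parent is not heavy. *)
case: k nA kmin => [|k] nA kmin.
  rewrite addr0 in nA; have AE := cube_disjoint nQ0 nA (AQ0 _ Ax) Ax.
  by move: lamA; rewrite -AE ltNge IQ0.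
have [P nP AP] := cube_parent nA.
have Px := AP _ Ax.
have muP := cube_parent_le nA nP AP.
rewrite -addn1 PoszD addrA addrK in nP.
have PQ0 : P `<=` Q0 by exact: cube_nested nQ0 nP (AQ0 _ Ax) Px.
have IP : (Iabs P <= lam%:E * mu P)%E.
  rewrite leNgt; apply/negP => lamP; apply: (kmin k P (ltnSn k) nP AP).
  by split=> //; exists k.
pose c := avg mu P f.
have c_le : `|c| <= lam.
  have := le_trans (normr_avg_le nP) IP.
  have := cube_gt0 nP; have := cube_fin_num nP.
  case: (mu P) => [m _| |]//; rewrite lte_fin -!EFinM lee_fin => m0.
  by rewrite ler_pM2r.
have Jle := integral_sub_avg_le nP cx Px.
have {}Jle : (\int[mu]_(y in P) `|f y - c|%:E <= (gam * lam * CD)%:E * mu A)%E.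
  apply: (le_trans Jle); apply: (@le_trans _ _ ((gam * lam)%:E * mu P)%E).
    by rewrite lee_wpmul2r.
  by rewrite [in leRHS]EFinM -muleA lee_wpmul2l// lee_fin mulr_ge0// ltW.
pose P' := [set B | heavy n0 Q0 (a * lam) B /\ B `<=` A].
have AU : A `&` \bigcup_(B in heavy n0 Q0 (a * lam)) B = \bigcup_(B in P') B.
  apply/seteqP; split=> [y [Ay [B hB By]]|y [B [hB BA] By]]; last first.
    by split; [exact: BA|exists B].
  exists B => //; split=> //.
  have hB' : heavy n0 Q0 lam B.
    by apply: heavy_mono hB; rewrite ler_peMl// ltW.
  have [_ [l nB] _] := hB.
  (* A heavy cube that meets [A] at a coarser level would contain [A] and contradict the stopping
     condition. *)
  have [lk|kl] := ltnP l k.+1.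
    have AB : A `<=` B.
      apply: (@cube_nested _ (k.+1 - l)%N _ _ y nB _ By Ay).
      by rewrite -addrA -PoszD subnKC// ltnW.
    by have := kmin _ _ lk nB AB.
  apply: (@cube_nested _ (l - k.+1)%N _ _ y nA _ Ay By).
  by rewrite -addrA -PoszD subnKC.
have mP' : measurable (\bigcup_(B in P') B).
  by rewrite -AU; apply: measurableI (cube_measurable nA) (measurable_heavy _ _ _).
(* This is [(a - 1) lam], the excess of the new level over the bound for [|c|]. *)
pose t := 2 * CD * gam * lam.
have t0 : 0 < t by rewrite !mulr_gt0// (lt_le_trans ltr01).
have : (t%:E * mu (\bigcup_(B in P') B) <= \int[mu]_(y in P) `|f y - c|%:E)%E.
  rewrite -(integral_cst mu mP').
  apply: (@le_trans _ _
    (\int[mu]_(y in \bigcup_(B in P') B) `|f y - c|%:E)%E); last first.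
    apply: ge0_subset_integral => //; first exact: cube_measurable nP.
      exact: measurable_funTS.
    by move=> y [B [_ BA] By]; exact/AP/BA.
  apply: (@le_integral_stopping n0) => //.
  - by move=> B [[]].
  - by move=> y; rewrite lee_fin ltW.
  move=> B [[[_ [l nB] aB] _] _].
  rewrite (integral_cst mu (cube_measurable nB)).
  have := lt_le_trans aB (integral_abs_sub_le c nB).
  have := cube_gt0 nB; have := cube_fin_num nB.
  have : (0 <= \int[mu]_(y in B) `|f y - c|%:E)%E.
    by apply: integral_ge0 => y _; rewrite lee_fin.
  case: (mu B) => [m| |]//; case: (integral _ _ _) => [j| |]//; last first.
    by move=> *; exact: leey.
  rewrite -!EFinM -EFinD !lee_fin !lte_fin => j0 _ m0 h.
  have : `|c| * m <= lam * m by rewrite ler_pM2r.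
  by rewrite /t /a in h *; nra.
rewrite AU => /le_trans/(_ Jle).
have := cube_fin_num nA; have : (mu (\bigcup_(B in P') B) <= mu A)%E.
  apply: subset_measure_le => //; first exact: cube_measurable nA.
  by rewrite -AU; exact: subIsetl.
have : (0 <= mu (\bigcup_(B in P') B))%E by [].
case: (mu A) => [m| |]//; case: (mu (\bigcup_(B in P') B)) => [u| |]//.
rewrite -!EFinM !lee_fin => u0 _ _.
have -> : t * u = (gam * lam * CD) * (2 * u) by rewrite /t; ring.
by rewrite ler_pM2l// !mulr_gt0// (lt_le_trans ltr01).
Qed.

(** [G] collects the points of [U'] in the core with [sharp <= gam lam]. A stopping cube of level
    [lam] that meets [G] satisfies [stopping_heavy_half], so [G] takes at most half of its measure
    and hence at most a fixed fraction of its weight. The rest of [U'] lies in [Z] up to a null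
    set. *)
Lemma good_lambda n0 Q0 lam gam :
  cube n0 Q0 -> 0 < lam -> 0 < gam -> (Iabs Q0 <= lam%:E * mu Q0)%E ->
  (om (\bigcup_(A in heavy n0 Q0 ((1 + 2 * CD * gam) * lam)) A) <=
    (1 - (CW 2)^-1)%:E * om (\bigcup_(A in heavy n0 Q0 lam) A) +
    om (Q0 `&` [set x | (gam * lam)%:E < sharp x]%E))%E.
Proof.
move=> nQ0 lam0 gam0 IQ0; set U' := \bigcup_(A in _) A.
set U := \bigcup_(A in heavy n0 Q0 lam) A; set Z := _ `&` _.
have C1 := CD_ge1.
have theta0 : 0 <= 1 - (CW 2)^-1.
  by rewrite subr_ge0 invf_le1 ?CW_ge1 ?ler1n// (lt_le_trans ltr01)// CW_ge1// ler1n.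
have mS : measurable [set x | (gam * lam)%:E < sharp x]%E.
  rewrite -[X in measurable X]setTI; apply: emeasurable_fun_o_infty => //.
  exact: measurable_sharp.
have mU' : measurable U' by exact: measurable_heavy.
have mU : measurable U by exact: measurable_heavy.
have U'U : U' `<=` U.
  move=> x [A hA' Ax]; exists A => //; apply: heavy_mono hA'.
  by rewrite ler_peMl ?(ltW lam0)// lerDl !mulr_ge0// ?(ltW gam0)// (le_trans ler01).
pose G := U' `&` (dyadic_core Q `\` [set x | (gam * lam)%:E < sharp x]%E).
have mG : measurable G.
  apply: measurableI => //; apply: measurableD => //; exact: measurable_core.
rewrite (om_splitD mU' mG); apply: leeD; last first.
  rewrite (om_splitD (measurableD mU' mG) mS) -[leRHS]adde0; apply: leeD.
    apply: om_le; [apply: measurableI => //; exact: measurableD| |].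
      by apply: measurableI => //; exact: cube_measurable nQ0.
    by move=> x [[U'x _] ?]; split=> //; exact: heavy_sub U'x.
  rewrite le_eqVlt; apply/orP; left; apply/eqP; apply: om_null.
    by apply: measurableD => //; exact: measurableD.
  apply: subset_measure0 mu_coreC; [|exact/measurableC/measurable_core|].
    by apply: measurableD => //; exact: measurableD.
  move=> x [[U'x nGx] nSx] cx; apply: nGx; split=> //.
have UG : U' `&` G = U `&` G.
  by apply/seteqP; split=> x [Ux Gx]; split=> //; [exact: U'U|case: Gx].
(* The weight of [G] is written as an integral over [U], so that both sides decompose along the same
   stopping cubes. *)
rewrite UG /weight_measure integral_mkcondr -ge0_integralZl//; last 2 first.
- exact: measurable_funTS.
- by move=> x _; rewrite lee_fin.
apply: (@le_integral_stopping n0) => //.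
- by move=> A [].
- apply/(measurable_restrictT _ _).1 => //; exact: measurable_funTS.
- exact: measurable_funeM.
- by move=> x; apply: erestrict_ge0 => y _; rewrite lee_fin.
- by move=> x; rewrite mule_ge0// lee_fin.
move=> A stA; have [[AQ0 _ _] [k nA _]] := stA.
have mA := cube_measurable nA.
rewrite -integral_mkcondr ge0_integralZl//; last 2 first.
- exact: measurable_funTS.
- by move=> x _; rewrite lee_fin.
rewrite -!/(weight_measure mu w _).
have [[x [Ax [_ [cx sx]]]]|noG] := pselect (A `&` G !=set0); last first.
  rewrite (_ : A `&` G = set0); last by apply/eqP; apply/negPn/negP => /set0P.
  by rewrite {1}/weight_measure integral_set0 mule_ge0 ?om_ge0.
apply: (cube_weight_half nA); [exact: measurableI|by move=> y []|].
apply: le_trans (stopping_heavy_half nQ0 lam0 gam0 IQ0 stA Ax cx _).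
  rewrite lee_wpmul2l// ?lee_fin//; apply: subset_measure_le.
  - exact: measurableI.
  - by apply: measurableI => //; exact: measurable_heavy.
  - by move=> y [Ay [U'y _]].
by rewrite leNgt; exact/negP.
Qed.

(** * Lebesgue differentiation along cubes *)

Let dist_abs (c : R) (y : X) : R := `| `|f y| - c |.

Let mdist_abs c : measurable_fun setT (dist_abs c).
Proof.
apply: measurableT_comp => //; apply: measurable_funB => //.
exact: measurableT_comp.
Qed.

Let emdist_abs c : measurable_fun setT (EFin \o dist_abs c).
Proof. exact/measurable_EFinP. Qed.

Let loc_integrable_dist_abs c : loc_integrable mu rho (dist_abs c).
Proof.
move=> x r r0; have mB := measurable_ball x r0.
have /integrableP[_ fB] := locf x r0.
apply/integrableP; split; first exact: measurable_funTS.
apply: (@le_lt_trans _ _ (\int[mu]_(y in ball x r) (`|f y|%:E + cst `|c|%:E y))%E).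
  apply: ge0_le_integral => //.
  - by apply: measurableT_comp => //; exact: measurable_funTS.
  - by apply: emeasurable_funD; [exact: measurable_funTS|exact: measurable_cst].
  - move=> y _; rewrite /= -EFinD lee_fin normr_id.
    by rewrite (le_trans (ler_normB _ _))// normr_id.
rewrite ge0_integralD//; last 2 first.
- exact: measurable_funTS.
- by move=> y _; rewrite lee_fin.
rewrite (integral_cst mu mB) lte_add_pinfty// lte_mul_pinfty// ?lee_fin//.
exact: ball_lty.
Qed.

Let exists_small_radius (n : int) (e : R) : 0 < e ->
  exists k : nat, (`|N0| + 1) * delta ^ (n + k%:Z - 1) < e.
Proof.
move=> e0; have [d0 d1] := andP hdelta.
have C0 : 0 < (`|N0| + 1) * delta ^ (n - 1) by exact: cube_radius_gt0.
have : (fun k => delta ^+ k) @ \oo --> (0 : R).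
  by apply: cvg_expr; rewrite gtr0_norm.
move=> /cvgr_lt/(_ (e / ((`|N0| + 1) * delta ^ (n - 1))))[|k _ hk].
  by rewrite divr_gt0.
exists k; have := hk k (leqnn k); rewrite /= ltr_pdivlMr// => h.
by rewrite addrAC expfzDr ?gt_eqF// mulrA mulrC.
Qed.

(* Differentiating [| |f| - c |] for all rational [c], and taking [c] close to
   [|f x|], makes up for the balls being larger than the cubes. *)
Lemma ae_le_heavy : {ae mu, forall x, dyadic_core Q x ->
  forall n0 Q0 (lam : R), cube n0 Q0 -> Q0 x -> 0 < lam -> lam < `|f x| ->
  (\bigcup_(A in heavy n0 Q0 lam) A) x}.
Proof.
(* An enumeration of the rationals, so that one null set serves all of them. *)
pose c (k : nat) : R := ratr (odflt (0 : rat) (choice.unpickle k)).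
have cP (r : rat) : c (choice.pickle r) = ratr r by rewrite /c choice.pickleK.
have := ae_foralln (fun k => homogeneous_differentiation hom
  (loc_integrable_dist_abs (c k))).
apply: filterS => x Hx cx n0 Q0 lam nQ0 Q0x lam0 lamf.
have C1 := CD_ge1.
(* For [c0] within [t0] below [|f x|], the mean of [| |f| - c0 |] over a small ball is less than
   [2 t0], hence less than [2 CD t0] over the cube. The mean of [|f|] over the cube then exceeds
   [c0 - 2 CD t0], which is more than [|f x| - (1 + 2 CD) t0 = lam]. *)
pose t0 := (`|f x| - lam) / (1 + 2 * CD).
have CD1 : 0 < 1 + 2 * CD by rewrite ltr_wpDr// mulr_ge0// (le_trans ler01).
have t00 : 0 < t0 by rewrite divr_gt0// subr_gt0.
have t0le : t0 <= `|f x| - lam.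
  rewrite ler_pdivrMr// ler_peMr ?subr_ge0 ?(ltW lamf)// lerDl.
  by rewrite mulr_ge0// (le_trans ler01).
have [|ck] := @rat_in_itvoo R (`|f x| - t0) (`|f x|).
  by rewrite ltrBlDr ltrDl.
rewrite in_itv/= => /andP[ck1 ck2].
have {Hx} := Hx (choice.pickle ck); rewrite cP; set c0 : R := ratr ck in ck1 ck2 *.
move=> /cvgr_lt/(_ (2 * (`|f x| - c0)))[|e /= e0 he].
  by rewrite /dist_abs gtr0_norm ?subr_gt0// ltr_pMl ?subr_gt0// ltr1n.
have [k hk] := exists_small_radius n0 e0.
have [A nA Ax] := core_cube (n0 + k%:Z) cx.
exists A => //; split; [exact: cube_nested nQ0 nA Q0x Ax|by exists k|].
set r := _ * _ in hk; have r0 : 0 < r by exact: cube_radius_gt0.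
have {he} := he r; rewrite /= sub0r normrN gtr0_norm// => /(_ hk r0).
have mA := cube_measurable nA; have mB := measurable_ball x r0.
have J0 : (0 <= \int[mu]_(y in ball x r) (EFin \o dist_abs c0) y)%E.
  by apply: integral_ge0 => y _; rewrite lee_fin normr_ge0.
have JAB : (\int[mu]_(y in A) (EFin \o dist_abs c0) y <=
    \int[mu]_(y in ball x r) (EFin \o dist_abs c0) y)%E.
  apply: ge0_subset_integral => //; first exact: measurable_funTS.
    by move=> y _; rewrite lee_fin normr_ge0.
  exact: cube_sub_parent_ball nA Ax.
have cA : (c0%:E * mu A <= Iabs A + \int[mu]_(y in A) (EFin \o dist_abs c0) y)%E.
  rewrite -(integral_cst mu mA) -ge0_integralD//; last 3 first.
  - exact: measurable_funTS.
  - by move=> y _; rewrite lee_fin normr_ge0.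
  - exact: measurable_funTS.
  apply: ge0_le_integral => //.
  - move=> y _; rewrite lee_fin ltW// (lt_trans lam0)// (le_lt_trans _ ck1)//.
    by rewrite lerBrDr addrC -lerBrDr.
  - by apply: emeasurable_funD; exact: measurable_funTS.
  move=> y _; rewrite -EFinD lee_fin -lerBlDl.
  by rewrite (le_trans (ler_norm _))// /dist_abs distrC.
have /integrable_fin_num := loc_integrable_dist_abs c0 x r0.
move=> /(_ mB).
move: J0 JAB; rewrite /avg /avge.
move: (\int[mu]_(y in ball x r) _)%E => [J| |]// J0 JAB _.
have := mu_ball_le_cube nA Ax; rewrite -/r.
have := ball_gt0 x r0; have := ball_lty x r0.
case: (mu (ball x r)) => [b _|//|//]; rewrite lte_fin => b0.
rewrite inver gt_eqF// -EFinM/=.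
have := cube_gt0 nA; have := cube_fin_num nA.
have := cube_Iabs_fin nA.
move: cA JAB.
have : (0 <= \int[mu]_(y in A) (EFin \o dist_abs c0) y)%E.
  by apply: integral_ge0 => y _; rewrite lee_fin normr_ge0.
case: (integral mu A (EFin \o dist_abs c0)) => [j| |]//.
case: (mu A) => [m| |]//; case: (Iabs A) => [i| |]//.
rewrite -!EFinM -!EFinD !lee_fin !lte_fin => j0 h1 h2 _ _ m0 h3 h4.
have h5 : J < 2 * (`|f x| - c0) * b by rewrite mulrC -ltr_pdivrMl.
have tE : t0 * (1 + 2 * CD) = `|f x| - lam.
  by rewrite divfK// gt_eqF.
have h6 : 2 * (`|f x| - c0) * b <= 2 * (`|f x| - c0) * (CD * m).
  by rewrite ler_wpM2l// mulr_ge0// subr_ge0 ltW.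
have h7 : (`|f x| - c0) * (CD * m) <= t0 * (CD * m).
  rewrite ler_wpM2r ?mulr_ge0 ?(ltW m0) ?(le_trans ler01)//.
  by rewrite lerBlDr addrC -lerBlDr ltW.
have h8 : (`|f x| - t0) * m < c0 * m by rewrite ltr_pM2r.
nra.
Qed.

(** * Norm estimates *)

Section Norm.
Variable p : R.
Hypothesis hp : 1 < p.

Let p0 : 0 < p. Proof. exact: lt_trans hp. Qed.

Local Notation FP := (fun x => `|(EFin \o f) x| `^ p * (w x)%:E)%E.
Local Notation SP := (fun x => `|sharp x| `^ p * (w x)%:E)%E.

Lemma measurable_FP : measurable_fun setT FP.
Proof.
apply: emeasurable_funM => //.
apply: (measurableT_comp (measurable_poweR p)); apply: measurableT_comp => //.
exact/measurable_EFinP.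
Qed.

Lemma measurable_SP : measurable_fun setT SP.
Proof.
apply: emeasurable_funM => //.
apply: (measurableT_comp (measurable_poweR p)); apply: measurableT_comp => //.
exact: measurable_sharp.
Qed.

Lemma FP_ge0 x : (0 <= FP x)%E.
Proof. by rewrite mule_ge0 ?poweR_ge0// lee_fin. Qed.

Lemma SP_ge0 x : (0 <= SP x)%E.
Proof. by rewrite mule_ge0 ?poweR_ge0// lee_fin. Qed.

Local Hint Resolve measurable_FP measurable_SP FP_ge0 SP_ge0 : core.

Lemma measurable_sum_indic (c : nat -> R) (U : nat -> set X) n :
  (forall k, measurable (U k)) ->
  measurable_fun setT (fun x => \sum_(k < n) c k * \1_(U k) x).
Proof.
by move=> mU; apply: measurable_sum => k; exact: measurable_funM.
Qed.

Lemma integral_sum_indic A (c : nat -> R) (U : nat -> set X) n :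
  measurable A -> (forall k, 0 <= c k) -> (forall k, measurable (U k)) ->
  (\int[mu]_(x in A) ((\sum_(k < n) c k * \1_(U k) x) * w x)%:E =
   \sum_(k < n) (c k)%:E * om (A `&` U k))%E.
Proof.
move=> mA c0 mU.
under eq_integral => x _ do rewrite big_distrl/= -sumEFin.
rewrite ge0_integral_sum//; last 2 first.
- move=> k; apply: measurable_funTS; apply/measurable_EFinP.
  apply: measurable_funM; last exact: Ap_measurable hw.
  exact: measurable_funM.
- by move=> k x _; rewrite lee_fin !mulr_ge0.
apply: eq_bigr => k _; rewrite /weight_measure integral_mkcondr.
rewrite -ge0_integralZl//; last 3 first.
- apply: measurable_funTS; apply/(measurable_restrictT _ _).1 => //.
  exact: measurable_funTS.
- by move=> x _; apply: erestrict_ge0 => y _; rewrite lee_fin.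
- by rewrite lee_fin.
apply: eq_integral => x _; rewrite patchE indicE; case: (x \in U k).
  by rewrite mulr1 EFinM.
by rewrite mulr0 mul0r mule0.
Qed.

(** The layer-cake sum bounds [|f|^p] through the sets [U k]; [good_lambda] yields a linear
    recurrence for their weights [x k], which is summed with the factors [b^k = a^(p k)]. The
    inhomogeneous terms [y k] add up to the integral of [SP]. *)
Lemma local_estimate n0 Q0 L :
  cube n0 Q0 -> 0 < L -> (Iabs Q0 <= L%:E * mu Q0)%E ->
  (\int[mu]_(x in Q0) FP x <= (local_constant (CW 2) CD p)%:E *
     ((L `^ p)%:E * om Q0 + \int[mu]_(x in Q0) SP x))%E.
Proof.
move=> nQ0 L0 IQ0.
have C1 : 1 <= CW 2 by rewrite CW_ge1// ler1n.
have D1 := CD_ge1.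
rewrite /local_constant; set C := CW 2 in C1 *.
set b := _ / (2 * C - 1); set gam := _ / (2 * CD).
have C2 : 0 < 2 * C - 1 by lra.
have b1 : 1 < b by rewrite ltr_pdivlMr//; lra.
have b0 : 0 < b by lra.
pose a := b `^ p^-1.
have ap : a `^ p = b by rewrite -powRrM mulVf ?gt_eqF// powRr1// ltW.
have a0 : 0 < a by exact: powR_gt0.
have a1 : 1 < a.
  rewrite ltNge; apply/negP => a1.
  have := ge0_ler_powR (ltW p0) (_ : a \is Num.nneg) (_ : 1 \is Num.nneg) a1.
  by rewrite ap powR1 !nnegrE (ltW a0) ler01 leNgt b1 => /(_ isT isT).
have g0 : 0 < gam by rewrite divr_gt0 ?subr_gt0// mulr_gt0// (lt_le_trans ltr01).
have aE : 1 + 2 * CD * gam = a.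
  rewrite /gam -/a; move: (CD) D1 => D D1.
  by field; rewrite gt_eqF//; lra.
have mQ0 := cube_measurable nQ0.
pose lam k := a ^+ k * L.
have lam0 k : 0 < lam k by rewrite mulr_gt0// exprn_gt0.
have lamL k : L <= lam k by rewrite ler_peMl ?(ltW L0)// exprn_ege1// ltW.
pose U k := \bigcup_(A in heavy n0 Q0 (lam k)) A.
pose Z k := Q0 `&` [set x | (gam * lam k)%:E < sharp x]%E.
have mU k : measurable (U k) by exact: measurable_heavy.
have mZ k : measurable (Z k).
  apply: measurableI => //; rewrite -[X in measurable X]setTI.
  by apply: emeasurable_fun_o_infty => //; exact: measurable_sharp.
have Q0fin := cube_om_lty nQ0.
have omfin A : measurable A -> A `<=` Q0 -> om A \is a fin_num.
  move=> mA AQ0; rewrite ge0_fin_numE ?om_ge0//.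
  by apply: le_lt_trans Q0fin; exact: om_le.
have UQ k : U k `<=` Q0 by exact: heavy_sub.
have ZQ k : Z k `<=` Q0 by move=> x [].
pose x k := fine (om (U k)); pose y k := fine (om (Z k)).
have x0 k : 0 <= x k by rewrite fine_ge0// om_ge0.
have xE k : om (U k) = (x k)%:E by rewrite fineK// omfin.
have yE k : om (Z k) = (y k)%:E by rewrite fineK// omfin.
pose W := fine (om Q0).
have WE : om Q0 = W%:E by rewrite fineK// omfin.
have xW : x 0%N <= W by rewrite -lee_fin -xE -WE; exact: om_le.
have W0 : 0 <= W by rewrite fine_ge0// om_ge0.
have xy k : x k.+1 <= (1 - C^-1) * x k + y k.
  have : (Iabs Q0 <= (lam k)%:E * mu Q0)%E.
    by apply: (le_trans IQ0); rewrite lee_wpmul2r// lee_fin.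
  move=> /(good_lambda nQ0 (lam0 k) g0); rewrite aE.
  rewrite (_ : a * lam k = lam k.+1); last by rewrite /lam exprS mulrA.
  by rewrite -/(U k) -/(U k.+1) -/(Z k) !xE yE -EFinM -EFinD lee_fin.
(* Absorption in the recurrence thus costs exactly the factor [2 C - 1] of [local_constant]. *)
have theta1 : (1 - b * (1 - C^-1)) = (2 * C - 1)^-1.
  by rewrite /b; field; rewrite !gt_eqF//; lra.
have Lp0 : 0 < L `^ p by exact: powR_gt0.
have gp0 : 0 < gam `^ p by exact: powR_gt0.
have b10 : 0 < b - 1 by rewrite subr_gt0.
(* The factor given by [sum_geometric_below] with [c = gam^p L^p] and [t] the [p]-th power of the
   sharp function. *)
pose kap := (gam `^ p * L `^ p)^-1 * (b / (b - 1)).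
have kap0 : 0 < kap.
  by apply: mulr_gt0; [rewrite invr_gt0; exact: mulr_gt0|exact: divr_gt0].
have Yle n : ((\sum_(k < n) b ^+ k * y k)%:E <=
    kap%:E * \int[mu]_(z in Q0) SP z)%E.
  rewrite -sumEFin.
  under eq_bigr => k _ do rewrite EFinM -yE -(setIidr (ZQ k)).
  rewrite -integral_sum_indic//; last by move=> k; rewrite exprn_ge0// ltW.
  rewrite -ge0_integralZl//; [|exact: measurable_funTS|by rewrite lee_fin ltW].
  apply: ge0_le_integral => //.
  - move=> z _; rewrite lee_fin mulr_ge0// sumr_ge0// => k _.
    by rewrite mulr_ge0// exprn_ge0// ltW.
  - apply: measurable_funTS; apply/measurable_EFinP; apply: measurable_funM.
      exact: measurable_sum_indic.
    exact: Ap_measurable hw.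
  - by apply: measurable_funTS; exact: measurable_funeM.
  move=> z Qz; have [wz0|wz0] := eqVneq (w z) 0.
    by rewrite wz0 mulr0 !mule0.
  have wz : 0 < w z by rewrite lt_neqAle eq_sym wz0 weight_ge0.
  have Zs k : z \in Z k -> ((gam * lam k)%:E < sharp z)%E by move=> /set_mem[].
  have := sharp_ge0 z; move: Zs; case: (sharp z) => [t| |]//; last first.
    by move=> _ _; rewrite /= gt_eqF// gt0_mulye ?lte_fin// gt0_muley ?lte_fin// leey.
  move=> Zs; rewrite lee_fin => t0.
  rewrite /= ger0_norm// -!EFinM lee_fin mulrA ler_pM2r//.
  rewrite /kap mulrAC [_ * t `^ p]mulrC.
  apply: le_trans (sum_geometric_below n b1 (mulr_gt0 gp0 Lp0) (powR_ge0 t p)).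
  apply: ler_sum => k _; rewrite ler_wpM2l ?exprn_ge0 ?(ltW b0)// indicE.
  rewrite ler_nat; case: (boolP (z \in _)) => // /Zs.
  rewrite lte_fin => h.
  suff -> : gam `^ p * L `^ p * b ^+ k < t `^ p by [].
  have ak0 : 0 <= a ^+ k by rewrite exprn_ge0// ltW.
  have gL0 : 0 <= gam * L by rewrite ltW// mulr_gt0.
  rewrite -ap -powR_expn ?(ltW a0)// -powRM ?(ltW g0) ?(ltW L0)// -powRM//.
  apply: gt0_ltr_powR; rewrite ?nnegrE ?(mulr_ge0 gL0 ak0)//.
  by rewrite (_ : _ * a ^+ k = gam * lam k)// /lam; ring.
pose c k := L `^ p * b ^+ k.+1.
have c0 k : 0 <= c k by rewrite mulr_ge0 ?exprn_ge0// ltW.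
(* On [E n] only [n] levels matter; monotone convergence in [n] recovers [Q0] at the end. *)
pose E n := Q0 `&` [set z | `|f z| <= L * a ^+ n].
have mE n : measurable (E n).
  apply: measurableI => //; rewrite -[X in measurable X]setTI.
  by apply: (measurable_fun_le measurableT) => //; exact: measurableT_comp.
pose G n z := ((L `^ p * w z)%:E + ((\sum_(k < n) c k * \1_(U k) z) * w z)%:E)%E.
have mG n : measurable_fun setT (G n).
  apply: emeasurable_funD; apply/measurable_EFinP; apply: measurable_funM => //.
  - exact: Ap_measurable hw.
  - exact: measurable_sum_indic.
  - exact: Ap_measurable hw.
have sum0 n z : 0 <= \sum_(k < n) c k * \1_(U k) z.
  by rewrite sumr_ge0// => k _; rewrite mulr_ge0.
have G0 n z : (0 <= G n z)%E.
  by rewrite adde_ge0// lee_fin mulr_ge0// ltW.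
have EG n : (\int[mu]_(z in E n) FP z <= \int[mu]_(z in Q0) G n z)%E.
  apply: (@le_trans _ _ (\int[mu]_(z in E n) G n z)%E); last first.
    by apply: ge0_subset_integral => //; [exact: measurable_funTS|move=> z []].
  apply: ae_ge0_le_integral => //; [exact: measurable_funTS|exact: measurable_funTS|].
  (* Almost every point where [|f|] exceeds [L a^k] lies in [U k], as [powR_le_level_sum] requires
     of the indicators. *)
  apply: filterS2 ae_core ae_le_heavy => z cz Hz [Qz fz].
  rewrite /G /= -EFinM -EFinD lee_fin -mulrDl ler_wpM2r//.
  rewrite /c -ap.
  apply: (@powR_le_level_sum _ a p L _ (fun k => \1_(U k) z)) => //;
    [exact: ltW|exact: ltW|].
  move=> k Lk; rewrite indicE mem_set//; apply: (Hz cz _ _ _ nQ0 Qz (lam0 k)).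
  by rewrite /lam mulrC.
have GW n : (\int[mu]_(z in Q0) G n z =
    (L `^ p * W + \sum_(k < n) c k * x k)%:E)%E.
  rewrite ge0_integralD//; last 4 first.
  - by move=> z _; rewrite lee_fin mulr_ge0// ltW.
  - apply: measurable_funTS; apply/measurable_EFinP; apply: measurable_funM => //.
    exact: Ap_measurable hw.
  - by move=> z _; rewrite lee_fin mulr_ge0.
  - apply: measurable_funTS; apply/measurable_EFinP; apply: measurable_funM.
      exact: measurable_sum_indic.
    exact: Ap_measurable hw.
  rewrite integral_sum_indic// EFinD; congr (_ + _)%E.
    rewrite EFinM -WE /weight_measure -ge0_integralZl//.
    - exact: measurable_funTS.
    - by move=> z _; rewrite lee_fin.
    - by rewrite lee_fin ltW.
  rewrite -sumEFin; apply: eq_bigr => k _.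
  by rewrite (setIidr (UQ k)) xE EFinM.
set t1 := b ^+ 3 * _ / _.
have t1E : t1 = b * b * (2 * C - 1) * (kap * L `^ p).
  by rewrite /t1 /kap; field; rewrite !gt_eqF.
have t10 : 0 <= t1.
  rewrite t1E; apply: mulr_ge0; last by apply: mulr_ge0; exact: ltW.
  by apply: mulr_ge0; [apply: mulr_ge0|]; exact: ltW.
have bC : 0 <= b * (2 * C - 1) by apply: mulr_ge0; exact: ltW.
have bound n : (\int[mu]_(z in E n) FP z <= (1 + b * (2 * C - 1) + t1)%:E *
    ((L `^ p)%:E * om Q0 + \int[mu]_(z in Q0) SP z))%E.
  apply: (le_trans (EG n)); rewrite GW WE.
  have := Yle n; have : (0 <= \int[mu]_(z in Q0) SP z)%E by apply: integral_ge0.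
  case: (integral mu Q0 SP) => [s| |]//; last first.
    move=> _ _; rewrite addey// gt0_muley ?leey// lte_fin.
    by rewrite -addrA ltr_pwDl// addr_ge0.
  rewrite -(EFinM (L `^ p)) -EFinD -!EFinM !lee_fin => s0 Yn.
  have sumE : \sum_(k < n) c k * x k = L `^ p * b * \sum_(k < n) b ^+ k * x k.
    by rewrite mulr_sumr; apply: eq_bigr => k _; rewrite /c exprS; ring.
  have := sum_linear_recurrence n (ltW b0) x0 xy; rewrite theta1 sumE.
  rewrite mulrC ler_pdivrMr// => Sn.
  have {}Sn : \sum_(k < n) b ^+ k * x k <= (W + b * (kap * s)) * (2 * C - 1).
    apply: (le_trans Sn); rewrite ler_pM2r//; apply: lerD => //.
    by rewrite ler_pM2l.
  have {}Sn : L `^ p * b * (\sum_(k < n) b ^+ k * x k) <=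
      L `^ p * b * ((W + b * (kap * s)) * (2 * C - 1)).
    by rewrite ler_pM2l// mulr_gt0.
  have h1 : 0 <= t1 * (L `^ p * W).
    by apply: mulr_ge0 => //; apply: mulr_ge0 => //; exact: ltW.
  have h2 : 0 <= b * (2 * C - 1) * s by rewrite mulr_ge0.
  have -> : (1 + b * (2 * C - 1) + t1) * (L `^ p * W + s) =
      L `^ p * W + L `^ p * b * ((W + b * (kap * s)) * (2 * C - 1))
      + (t1 * (L `^ p * W) + b * (2 * C - 1) * s + s).
    by rewrite t1E; ring.
  apply: (@le_trans _ _
    (L `^ p * W + L `^ p * b * ((W + b * (kap * s)) * (2 * C - 1)))).
    by rewrite lerD2l.
  by rewrite lerDl !addr_ge0.
have QE : Q0 = \bigcup_n E n.
  apply/seteqP; split=> [z Qz|z [n _ []]//].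
  have [n hn] := exists_lt_expr (`|f z| / L) a1.
  exists n => //; split=> //=.
  by rewrite -ler_pdivrMl// mulrC ltW.
have ndE : nondecreasing_seq E.
  move=> m n mn; apply/subsetPset => z [Qz /= fz]; split=> //=.
  by rewrite (le_trans fz)// ler_pM2l// ler_weXn2l// ltW.
have := @ge0_nondecreasing_set_cvg_integral _ _ _ E FP mu ndE mE.
rewrite -QE => /(_ _ _)/cvge_to_le; apply => //.
- by move=> i; exact: measurable_funTS.
- by apply: nearW.
Qed.

Lemma cube_FP_null n Q0 : cube n Q0 -> Iabs Q0 = 0%E ->
  (\int[mu]_(x in Q0) FP x = 0)%E.
Proof.
move=> nQ0 I0; have mQ0 := cube_measurable nQ0.
have f0 : ae_eq mu Q0 (EFin \o f) (cst 0).
  apply/ae_eq_integral_abs => //.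
  by apply: measurable_funTS; exact/measurable_EFinP.
transitivity (\int[mu]_(x in Q0) cst 0 x)%E; last by rewrite integral0.
apply: ge0_ae_eq_integral => //.
- exact: measurable_funTS.
- move: f0; apply: filterS => x fx Qx; have := fx Qx.
  by rewrite /= => -[->]; rewrite normr0 powR0 ?gt_eqF// mul0e.
Qed.

Lemma weight_const_int A v : measurable A -> 0 <= v ->
  (v%:E * om A = \int[mu]_(x in A) (v%:E * (w x)%:E))%E.
Proof.
move=> mA v0; rewrite ge0_integralZl//; first exact: measurable_funTS.
by move=> x _; rewrite lee_fin.
Qed.

Lemma mean_power_le n Q0 E a :
  cube n Q0 -> measurable E -> E `<=` Q0 -> (mu Q0 <= 4%:E * mu E)%E ->
  0 < a -> Iabs Q0 = (a%:E * mu Q0)%E ->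
  ((a `^ p)%:E * om Q0 <= (16 `^ p)%:E * \int[mu]_(x in Q0) SP x +
    (2 `^ p * CW 16)%:E * \int[mu]_(x in E) FP x)%E.
Proof.
move=> nQ0 mE EQ0 QE a0 Ia; have mQ0 := cube_measurable nQ0.
pose c := avg mu Q0 f; pose J := (\int[mu]_(y in Q0) `|f y - c|%:E)%E.
have J0 : (0 <= J)%E by apply: integral_ge0 => y _; rewrite lee_fin.
have SP0 : (0 <= \int[mu]_(x in Q0) SP x)%E by exact: integral_ge0.
have FP0 : (0 <= \int[mu]_(x in E) FP x)%E by exact: integral_ge0.
have mu0 := cube_gt0 nQ0.
have mufin := cube_fin_num nQ0.
have C1 : 1 <= CW 16 by rewrite CW_ge1// ler1n.
(* If the mean oscillation [J / mu Q0] is at least [a / 16], so is [f#] on [Q0];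
   otherwise [|f| >= a / 2] on a large part [E'] of [E]. *)
have [aJ|Ja] := leP (a%:E * mu Q0)%E (16%:E * J)%E.
  rewrite -[leLHS]adde0; apply: leeD; last first.
    by rewrite mule_ge0// lee_fin mulr_ge0 ?powR_ge0// (le_trans ler01).
  rewrite weight_const_int ?powR_ge0// -ge0_integralZl ?lee_fin ?powR_ge0//; last first.
    exact: measurable_funTS.
  apply: ae_ge0_le_integral => //.
  - by move=> x _; rewrite -EFinM lee_fin mulr_ge0 ?powR_ge0.
  - by apply: measurable_funTS; exact: measurable_funeM.
  - by move=> x _; rewrite mule_ge0// lee_fin powR_ge0.
  - by apply: measurable_funTS; exact: measurable_funeM.
  move: ae_core; apply: filterS => x cx Qx.
  rewrite muleA lee_wpmul2r ?lee_fin//.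
  have := integral_sub_avg_le nQ0 cx Qx; rewrite -/c -/J.
  have := sharp_ge0 x.
  case: (sharp x) => [s| |]//; last first.
    by move=> _ _; rewrite /= gt_eqF// gt0_muley ?leey// lte_fin powR_gt0.
  rewrite lee_fin => s0 Js; rewrite /= ger0_norm// -EFinM lee_fin.
  rewrite -powRM//; apply: ge0_ler_powR; rewrite ?nnegrE ?mulr_ge0 ?(ltW a0) ?(ltW p0)//.
  have := le_trans aJ (lee_wpmul2l (_ : 0 <= 16%:E)%E Js).
  rewrite lee_fin ler0n => /(_ isT); move: mu0 mufin.
  case: (mu Q0) => [m| |]//; rewrite lte_fin -!EFinM lee_fin => m0 _.
  by rewrite mulrA ler_pM2r.
pose E' := E `&` [set x | a / 2 <= `|f x|].
have mE' : measurable E'.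
  apply: measurableI => //; rewrite -[X in measurable X]setTI.
  by apply: (measurable_fun_le measurableT) => //; exact: measurableT_comp.
have mD : measurable (E `\` E') by exact: measurableD.
have E'Q : E' `<=` Q0 by move=> x [/EQ0].
have Jc := integral_abs_sub_le c nQ0; rewrite -/J Ia in Jc.
(* Here [7/16 = 15/16 - 1/2], since [|f| < a / 2] on [E] outside [E']. The bound on [|c|] holds
   because [|f|] has mean [a] and the oscillation is below [a / 16]. *)
have cheb : a * 15 / 16 <= `|c| -> ((7 * a / 16)%:E * mu (E `\` E') <= J)%E.
  move=> ca; rewrite -(integral_cst mu mD).
  apply: (@le_trans _ _ (\int[mu]_(y in E `\` E') `|f y - c|%:E)%E).
    apply: ge0_le_integral => //.
    - by move=> x _; rewrite lee_fin divr_ge0// mulr_ge0// ltW.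
    - exact: measurable_funTS.
    move=> x [Ex nE']; rewrite lee_fin distrC.
    have fx : `|f x| < a / 2.
      by rewrite ltNge; apply/negP => af; apply: nE'.
    have := lerB_dist c (f x); lra.
  apply: ge0_subset_integral => //; first exact: measurable_funTS.
  by move=> x [/EQ0].
(* The part of [E] outside [E'] has measure less than [mu Q0 / 7], and [1/4 - 1/7 > 1/16]. *)
have QE' : (mu Q0 <= 16%:E * mu E')%E.
  have muE : mu E = (mu E' + mu (E `\` E'))%E.
    rewrite -measureU//; first by rewrite setDUK// => x [].
    by rewrite setDIK.
  move: QE; rewrite muE.
  have : (mu (E `\` E') <= mu Q0)%E.
    by apply: subset_measure_le => // x [/EQ0].
  have : (mu E' <= mu Q0)%E by exact: subset_measure_le.
  move: cheb Jc Ja J0 mufin mu0; have : (0 <= mu E')%E by [].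
  have : (0 <= mu (E `\` E'))%E by [].
  case: (mu Q0) => [m| |]//; case: (mu E') => [e'| |]//.
  case: (mu (E `\` E')) => [u| |]//.
  case: (J) => [j| |]//; last first.
    by move=> u0 e0 _ _; rewrite gt0_muley ?lte_fin.
  move=> u0 e0 ch Jc Ja J0' _ m0 e'm um h.
  rewrite -EFinM lee_fin.
  rewrite -EFinD -EFinM lee_fin in h; rewrite -!EFinM -EFinD lee_fin in Jc.
  rewrite -!EFinM lte_fin in Ja; rewrite !lee_fin in u0 e0 J0' e'm um.
  rewrite lte_fin in m0.
  have ca : a * 15 / 16 <= `|c|.
    rewrite -(ler_pM2r m0); nra.
  by have := ch ca; rewrite -EFinM lee_fin => chu; nra.
have [_ omE'] := cube_weight_le nQ0 mE' E'Q QE'.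
rewrite -[leLHS]add0e; apply: leeD; first by rewrite mule_ge0// lee_fin powR_ge0.
apply: (@le_trans _ _ ((a `^ p)%:E * ((CW 16)%:E * om E'))%E).
  by rewrite lee_wpmul2l// lee_fin powR_ge0.
have -> : a `^ p = 2 `^ p * (a / 2) `^ p.
  by rewrite -powRM ?divr_ge0 ?(ltW a0)// mulrC divfK.
rewrite muleA -EFinM mulrAC EFinM -muleA lee_wpmul2l//.
  by rewrite lee_fin mulr_ge0 ?powR_ge0// (le_trans ler01).
apply: (@le_trans _ _ (\int[mu]_(x in E') FP x)%E); last first.
  by apply: ge0_subset_integral => //; [exact: measurable_funTS|move=> x []].
rewrite (weight_const_int mE' (powR_ge0 (a / 2) p)).
apply: ge0_le_integral; first exact: mE'.
- by move=> x _; rewrite -EFinM lee_fin mulr_ge0 ?powR_ge0.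
- by apply: measurable_funTS; exact: measurable_funeM.
- exact: measurable_funTS.
move=> x [_ /= ax]; rewrite -EFinM lee_fin ler_wpM2r//.
by apply: ge0_ler_powR; rewrite ?nnegrE ?divr_ge0 ?(ltW a0) ?(ltW p0).
Qed.

Let Kloc := local_constant (CW 2) CD p.
Let Kosc := oscillation_constant (CW 2) (CW 16) CD p.

Let Kloc_ge0 : 0 <= Kloc.
Proof. by apply: local_constant_ge0 => //; rewrite CW_ge1// ler1n. Qed.

Let Kosc_ge0 : 0 <= Kosc.
Proof.
rewrite mulr_ge0// !addr_ge0 ?powR_ge0// mulr_ge0 ?powR_ge0//.
by rewrite (le_trans ler01)// CW_ge1// ler1n.
Qed.

(** [local_estimate] is used with [L] equal to the mean of [|f|], and [mean_power_le] bounds the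
    resulting term. A zero mean is treated apart, as [L] must be positive. *)
Lemma oscillation_estimate n Q0 E :
  cube n Q0 -> measurable E -> E `<=` Q0 -> (mu Q0 <= 4%:E * mu E)%E ->
  (\int[mu]_(x in Q0) FP x <=
   Kosc%:E * (\int[mu]_(x in Q0) SP x + \int[mu]_(x in E) FP x))%E.
Proof.
move=> nQ0 mE EQ0 QE.
have SP0 : (0 <= \int[mu]_(x in Q0) SP x)%E by exact: integral_ge0.
have FP0 : (0 <= \int[mu]_(x in E) FP x)%E by exact: integral_ge0.
have C1 : 1 <= CW 16 by rewrite CW_ge1// ler1n.
have k0 : 0 <= 2 `^ p * CW 16.
  by rewrite mulr_ge0 ?powR_ge0// (le_trans ler01).
have k1 : 0 <= 16 `^ p :> R by exact: powR_ge0.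
have mu0 := cube_gt0 nQ0; have mufin := cube_fin_num nQ0.
have Ifin := cube_Iabs_fin nQ0.
have I0 : (0 <= Iabs Q0)%E by apply: integral_ge0 => y _; rewrite lee_fin.
have [Iz|In0] := eqVneq (Iabs Q0) 0%E.
  by rewrite (cube_FP_null nQ0 Iz); apply: mule_ge0 => //; exact: adde_ge0.
pose a := fine (Iabs Q0) / fine (mu Q0).
have m0 : 0 < fine (mu Q0) by rewrite fine_gt0// mu0 ltey_eq mufin.
have a0 : 0 < a.
  by rewrite divr_gt0// fine_gt0// lt0e In0 I0/= ltey_eq Ifin.
have Ia : Iabs Q0 = (a%:E * mu Q0)%E.
  by rewrite -[in RHS](fineK mufin) -EFinM divfK ?gt_eqF// fineK.
have := local_estimate nQ0 a0 (_ : Iabs Q0 <= a%:E * mu Q0)%E.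
rewrite {1}Ia lexx => /(_ isT)/le_trans; apply.
rewrite EFinM -muleA lee_wpmul2l//.
apply: le_trans (leeD (mean_power_le nQ0 mE EQ0 QE a0 Ia) (lexx _)) _.
move: SP0 FP0; move: (integral mu Q0 SP) (integral mu E FP) => S T S0 T0.
have -> : ((16 `^ p)%:E * S + (2 `^ p * CW 16)%:E * T + S =
    (16 `^ p + 1)%:E * S + (2 `^ p * CW 16)%:E * T)%E.
  by rewrite EFinD ge0_muleDl// mul1e addeAC.
rewrite ge0_muleDr//; apply: leeD.
  by rewrite lee_wpmul2r// lee_fin addrAC lerDl.
by rewrite lee_wpmul2r// lee_fin -addrA addrCA lerDl addr_ge0.
Qed.

(** * Spaces of infinite measure *)

Lemma bigcup_ball x (r : nat -> R) : (forall t, exists k, t < r k) ->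
  \bigcup_k ball x (r k) = setT.
Proof.
by move=> rP; apply/seteqP; split=> // y _; have [k hk] := rP (rho x y); exists k.
Qed.

Lemma exists_radius_gt n t :
  exists k : nat, t < (`|N0| + 1) * delta ^ (n - k%:Z).
Proof.
have d0 := delta_gt0; have [_ d1] := andP hdelta.
have : 1 < delta^-1 by rewrite invf_gt1.
move=> /(exists_lt_expr (t / ((`|N0| + 1) * delta ^ n)))[k hk]; exists k.
have C0 := cube_radius_gt0 n.
rewrite ltr_pdivrMr// in hk.
by rewrite expfzDr ?gt_eqF// mulrA mulrC -exprz_inv.
Qed.

Lemma radius_mono n (k l : nat) : (k <= l)%N ->
  (`|N0| + 1) * delta ^ (n - k%:Z) <= (`|N0| + 1) * delta ^ (n - l%:Z).
Proof.
elim: l => [|l IH]; first by rewrite leqn0 => /eqP ->.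
rewrite leq_eqVlt => /predU1P[->//|]; rewrite ltnS => /IH/le_trans; apply.
by rewrite ler_wpM2l ?addr_ge0// subz_succ delta_exp_le.
Qed.

(** For a cube [A] of level [n] the family has one member, the ancestor [k] levels up; taking the
    union avoids a choice. *)
Definition tower n (A : set X) (k : nat) : set X :=
  \bigcup_(P in [set P | cube (n - k%:Z) P /\ A `<=` P]) P.

Lemma towerE n A k P : cube n A -> cube (n - k%:Z) P -> A `<=` P ->
  tower n A k = P.
Proof.
move=> nA nP AP; have [z Az _] := cube_center nA.
apply/seteqP; split=> [x [P' [nP' AP'] P'x]|x Px]; last by exists P.
by rewrite (cube_disjoint nP nP' (AP _ Az) (AP' _ Az)).
Qed.

Lemma cube_tower n A k : cube n A -> cube (n - k%:Z) (tower n A k).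
Proof.
by move=> nA; have [P nP AP] := cube_ancestor k nA; rewrite (towerE nA nP AP).
Qed.

Lemma sub_tower n A k : cube n A -> A `<=` tower n A k.
Proof.
by move=> nA; have [P nP AP] := cube_ancestor k nA; rewrite (towerE nA nP AP).
Qed.

Lemma tower_nondecreasing n A : cube n A -> nondecreasing_seq (tower n A).
Proof.
move=> nA; apply/nondecreasing_seqP => k; apply/subsetPset.
have [P nP tP] := cube_parent (cube_tower k nA).
rewrite (@towerE n A k.+1 P nA)//.
  by rewrite subz_succ.
exact: subset_trans (sub_tower k nA) tP.
Qed.

(** The towers need not exhaust [X], but the balls of the parent levels around a fixed point of [A]
    do, and their measures are at most [CD] times those of the towers. *)
Lemma tower_unbounded n A M : cube n A -> mu setT = +oo%E ->
  exists k0, forall k, (k0 <= k)%N -> (M%:E <= mu (tower n A k))%E.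
Proof.
move=> nA muT; have [z Az _] := cube_center nA.
pose B k := ball z ((`|N0| + 1) * delta ^ (n - k%:Z - 1)).
have mB k : measurable (B k) by exact/measurable_ball/cube_radius_gt0.
have C1 := CD_ge1.
have : mu \o B @ \oo --> mu (\bigcup_k B k).
  apply: nondecreasing_cvg_mu => //; first exact: bigcup_measurable.
  move=> k l kl; apply/subsetPset/ball_sub.
  by rewrite ![n - _ - 1]addrAC; exact: radius_mono.
rewrite bigcup_ball; last first.
  by move=> t; have [k hk] := exists_radius_gt (n - 1) t; exists k; rewrite addrAC.
rewrite muT => /cvgeyPge/(_ (CD * M))[k0 _ hk0]; exists k0 => k k0k.
have := le_trans (hk0 k k0k) (mu_ball_le_cube (cube_tower k nA) (sub_tower k nA Az)).
by rewrite EFinM lee_pmul2l// lte_fin (lt_le_trans ltr01).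
Qed.

(** With [E] the difference of two towers, the integral of [FP] over the smaller one is bounded by
    [Kosc] times the sum of the integral of [SP] and the integral of [FP] over the rest of [T]. The
    rest is the finite total minus the left side, so it can be absorbed. *)
Lemma tower_estimate n A : cube n A -> mu setT = +oo%E ->
  (\int[mu]_x FP x < +oo)%E ->
  (\int[mu]_(x in \bigcup_k tower n A k) FP x <=
   Kosc%:E * \int[mu]_(x in \bigcup_k tower n A k) SP x)%E.
Proof.
move=> nA muT Ffin; set T := \bigcup_k _.
have mt k : measurable (tower n A k) by exact: cube_measurable (cube_tower k nA).
have mT : measurable T by exact: bigcup_measurable.
have tT k : tower n A k `<=` T by move=> x tx; exists k.
have step k : (\int[mu]_(x in tower n A k) FP x <=
    Kosc%:E * (\int[mu]_(x in T) SP x + \int[mu]_(x in T `\` tower n A k) FP x))%E.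
  have mufin := cube_fin_num (cube_tower k nA).
  (* Once the measure has doubled, the difference of the towers carries at least half of the larger
     one. *)
  have [k0 hk0] := tower_unbounded (2 * fine (mu (tower n A k))) nA muT.
  pose j := maxn k k0.
  have tkj : tower n A k `<=` tower n A j.
    by apply/subsetPset; exact: tower_nondecreasing nA _ _ (leq_maxl _ _).
  have muj := hk0 j (leq_maxr _ _).
  have mD : measurable (tower n A j `\` tower n A k) by exact: measurableD.
  apply: (@le_trans _ _ (\int[mu]_(x in tower n A j) FP x)%E).
    by apply: ge0_subset_integral => //; exact: measurable_funTS.
  apply: le_trans (oscillation_estimate (cube_tower j nA) mD _ _) _.
  - by move=> x [].
  - have muE : mu (tower n A j) =
        (mu (tower n A k) + mu (tower n A j `\` tower n A k))%E.
      rewrite -measureU//; first by rewrite setDUK.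
      by rewrite setDIK.
    have := cube_fin_num (cube_tower j nA); move: muj mufin; rewrite muE.
    have : (0 <= mu (tower n A k))%E by [].
    move: (mu (tower n A k)) (mu (_ `\` _)) => [u| |] [v| |]// u0 h _ _.
    rewrite -EFinD lee_fin/= in h; rewrite lee_fin in u0.
    by rewrite -EFinM -EFinD lee_fin; lra.
  apply: lee_wpmul2l => //; apply: leeD.
    by apply: ge0_subset_integral => //; exact: measurable_funTS.
  apply: ge0_subset_integral => //; first exact: measurableD.
    exact: measurable_funTS.
  by move=> x [tx ntx]; split=> //; exact: tT tx.
have Tfin : (\int[mu]_(x in T) FP x < +oo)%E.
  apply: le_lt_trans Ffin; apply: ge0_subset_integral => //.
have TE k : (\int[mu]_(x in T) FP x = \int[mu]_(x in tower n A k) FP x +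
    \int[mu]_(x in T `\` tower n A k) FP x)%E.
  rewrite -ge0_integral_setU//; first by rewrite setDUK//; exact: tT.
  - exact: measurableD.
  - exact: measurable_funTS.
  - by rewrite disj_set2E setDIK.
have FT0 : (0 <= \int[mu]_(x in T) FP x)%E by exact: integral_ge0.
have ST0 : (0 <= \int[mu]_(x in T) SP x)%E by exact: integral_ge0.
(* An infinite right side is not automatic: [0 * +oo = 0], so [Kosc = 0] is handled separately. *)
have [Soo|Sfin] := eqVneq (\int[mu]_(x in T) SP x)%E +oo%E.
  have [Kz|Kn0] := eqVneq Kosc 0; last first.
    by rewrite Soo gt0_muley ?leey// lte_fin lt_neqAle eq_sym Kn0.
  rewrite Kz mul0e.
  have := @ge0_nondecreasing_set_cvg_integral _ _ _ (tower n A) FP mu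
    (tower_nondecreasing nA) mt.
  move=> /(_ _ _)/cvge_to_le; apply => //; first by move=> i; exact: measurable_funTS.
  by apply: nearW => k; have := step k; rewrite Kz mul0e.
have cvgF := @ge0_nondecreasing_set_cvg_integral _ _ _ (tower n A) FP mu
  (tower_nondecreasing nA) mt (fun i => measurable_funTS measurable_FP)
  (fun i x _ => FP_ge0 x).
pose s := fine (\int[mu]_(x in T) SP x); pose t := fine (\int[mu]_(x in T) FP x).
have sE : (\int[mu]_(x in T) SP x = s%:E)%E by rewrite fineK// ge0_fin_numE// ltey.
have tE : (\int[mu]_(x in T) FP x = t%:E)%E by rewrite fineK// ge0_fin_numE.
(* With [u + v = t], the bound [u <= Kosc (s + v)] reads [(1 + Kosc) u <= Kosc (s + t)]. In the
   limit [u] becomes [t], and cancelling [Kosc t] leaves [t <= Kosc s]. *)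
have : (\int[mu]_(x in T) FP x <= ((1 + Kosc)^-1 * (Kosc * (s + t)))%:E)%E.
  apply: (cvge_to_le cvgF); apply: nearW => k.
  have := step k; have := TE k; rewrite sE tE.
  have : (0 <= \int[mu]_(x in tower n A k) FP x)%E by exact: integral_ge0.
  have : (0 <= \int[mu]_(x in T `\` tower n A k) FP x)%E by exact: integral_ge0.
  case: (integral mu (T `\` tower n A k) FP) => [v| |]//; last first.
    by case: (integral mu (tower n A k) FP) => [u| |].
  case: (integral mu (tower n A k) FP) => [u| |]// _ _ [tuv].
  rewrite -EFinD -EFinM !lee_fin tuv => h.
  by rewrite ler_pdivlMl ?ltr_pwDl//; nra.
rewrite tE sE -EFinM !lee_fin ler_pdivlMl ?ltr_pwDl// => h; nra.
Qed.

(** Two unions of towers that meet share all ancestors from some level on, hence coincide. The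
    distinct ones form a countable partition of a set containing the core. *)
Lemma infinite_estimate : mu setT = +oo%E -> (\int[mu]_x FP x < +oo)%E ->
  (\int[mu]_x FP x <=
   Kosc%:E * \int[mu]_x SP x)%E.
Proof.
move=> muT Ffin.
pose T A := \bigcup_k tower 0 A k.
have mT A : cube 0 A -> measurable (T A).
  by move=> nA; apply: bigcup_measurable => k _; exact: cube_measurable (cube_tower k nA).
have TT A B x : cube 0 A -> cube 0 B -> T A x -> T B x -> T A = T B.
  move=> nA nB [k _ Ak] [l _ Bl].
  have jA := subsetPset _ _ (tower_nondecreasing nA (leq_maxl k l)).
  have AB m : (maxn k l <= m)%N -> tower 0 A m = tower 0 B m.
    move=> klm; apply: (@cube_disjoint _ _ _ x (cube_tower m nA) (cube_tower m nB)).
      apply: (subsetPset _ _ (tower_nondecreasing nA _)) Ak.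
      exact: leq_trans (leq_maxl _ _) klm.
    apply: (subsetPset _ _ (tower_nondecreasing nB _)) Bl.
    exact: leq_trans (leq_maxr _ _) klm.
  apply/seteqP; split=> y [m _ ty]; exists (maxn m (maxn k l)) => //.
    rewrite -AB ?leq_maxr//.
    by apply: (subsetPset _ _ (tower_nondecreasing nA _)) ty; exact: leq_maxl.
  rewrite AB ?leq_maxr//.
  by apply: (subsetPset _ _ (tower_nondecreasing nB _)) ty; exact: leq_maxl.
pose F := T @` cube 0.
have cF : countable F by exact: sub_countable (card_image_le _ _) (countable_cube 0).
have mF B : F B -> measurable B by move=> [A nA <-]; exact: mT.
have mU : measurable (\bigcup_(B in F) B).
  rewrite (_ : \bigcup_(B in F) B =
      \bigcup_(B in [set B | exists2 A, cube 0 A & exists k, B = tower 0 A k]) B).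
    by apply: measurable_bigcup_cubes => _ [A nA [k ->]]; eexists; exact: cube_tower.
  apply/seteqP; split=> [x [_ [A nA <-] [k _ tx]]|x [_ [A nA [k ->]] tx]].
    by exists (tower 0 A k) => //; exists A => //; exists k.
  by exists (T A); [exists A|exists k].
have mKS : measurable_fun setT (fun x => Kosc%:E * SP x)%E by exact: measurable_funeM.
have KS0 x : (0 <= Kosc%:E * SP x)%E by rewrite mule_ge0.
have main : (\int[mu]_(x in \bigcup_(B in F) B) FP x <=
    \int[mu]_(x in \bigcup_(B in F) B) (Kosc%:E * SP x))%E.
  apply: le_integral_disjoint_cover => //.
  - move=> _ _ [A nA <-] [B nB <-] [x [Ax Bx]]; exact: TT nA nB Ax Bx.
  - move=> _ [A nA <-]; rewrite ge0_integralZl//; last 2 first.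
    + exact: mT.
    + exact: measurable_funTS.
    exact: tower_estimate.
have -> : (Kosc%:E * \int[mu]_x SP x = \int[mu]_x (Kosc%:E * SP x))%E.
  by rewrite ge0_integralZl.
rewrite (@ge0_negligible_integral _ _ _ mu setT
  (~` \bigcup_(B in F) B))//; last 2 first.
- exact: measurableC.
- apply: (subset_measure0 _ _ _ mu_coreC).
  + exact: measurableC.
  + exact/measurableC/measurable_core.
  apply: subsetC => x /(core_cube 0)[A nA Ax]; exists (T A); first by exists A.
  by exists 0%N => //; exact: sub_tower.
rewrite setTD setCK; apply: (le_trans main).
by apply: ge0_subset_integral.
Qed.

(** * Spaces of finite measure *)

(* Otherwise, around two points at a large distance [D] the balls of radius
   [D / (2 C)] are disjoint and of comparable measure, so the one around [x0] has
   measure at most a fixed fraction of [mu X], whereas it exhausts [X]. *)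
Lemma exists_diameter : (mu setT < +oo)%E -> exists r, forall x y, rho x y < r.
Proof.
move=> muT; have x0 : X by exact: point.
pose C := `|K1| + 1; have C1 : 1 <= C by rewrite lerDr.
have C0 : 0 < C by exact: lt_le_trans C1.
suff [r hr] : exists r, forall y, rho x0 y < r.
  exists (C * (r + r)) => x y; apply: le_lt_trans (rho_triangle x y x0) _.
  by rewrite ltr_pM2l// ltrD// rhoC.
apply: contrapT => nr.
have far r : exists y, r <= rho x0 y.
  apply: contrapT => ny; apply: nr; exists r => y; rewrite ltNge.
  by apply/negP => ry; apply: ny; exists y.
(* If the centers are at distance [2 C s], the ball of radius [4 C^2 s] around one contains the ball
   of radius [s] around the other; [m] doublings reach that radius. *)
have [m hm] := exists_lt_expr (4 * C * C) (ltr1n R 2 : 1 < 2).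
pose kap : R := Num.max 1 K2 ^+ m.
have kap1 : 1 <= kap by rewrite exprn_ege1// le_max lexx.
have kap0 : 0 < kap by exact: lt_le_trans kap1.
have muT0 : (0 < mu setT)%E.
  apply: lt_le_trans (ball_gt0 x0 ltr01) _; apply: subset_measure_le => //.
  exact: measurable_ball.
pose M := fine (mu setT).
have ME : mu setT = M%:E by rewrite fineK// ge0_fin_numE.
have M0 : 0 < M by rewrite -lte_fin -ME.
have ballM (k : nat) : (mu (ball x0 k.+1%:R) <= (kap / (1 + kap) * M)%:E)%E.
  have [y hy] := far (2 * C * k.+1%:R).
  set D := rho x0 y in hy.
  have k0 : 0 < k.+1%:R :> R by [].
  have D0 : 0 < D by apply: lt_le_trans hy; rewrite !mulr_gt0.
  pose s := D / (2 * C).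
  have C20 : 0 < 2 * C by rewrite mulr_gt0.
  have s0 : 0 < s by rewrite divr_gt0.
  have DE : D = 2 * C * s by rewrite /s mulrC divfK// gt_eqF.
  have ks : k.+1%:R <= s by rewrite /s ler_pdivlMr// mulrC.
  have disj : ball x0 s `&` ball y s = set0.
    apply/seteqP; split=> // z [x0z yz]; move: (rho_triangle x0 y z).
    rewrite -/D -/C DE leNgt => /negP; apply.
    rewrite (_ : 2 * C * s = C * (s + s)); last by ring.
    by rewrite ltr_pM2l// (rhoC z y); exact: ltrD.
  have sum_le : (mu (ball x0 s) + mu (ball y s) <= M%:E)%E.
    rewrite -ME -measureU//; [|exact: measurable_ball|exact: measurable_ball].
    apply: subset_measure_le => //.
    by apply: measurableU; exact: measurable_ball.
  have comp : (mu (ball x0 s) <= kap%:E * mu (ball y s))%E.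
    apply: le_trans (iter_doubling y m s0); apply: subset_measure_le.
    - exact: measurable_ball.
    - by apply: measurable_ball; rewrite mulr_gt0// exprn_gt0.
    move=> z; rewrite /qball/= => x0z; apply: le_lt_trans (rho_triangle y z x0) _.
    rewrite (rhoC y x0) -/D -/C; apply: (@lt_trans _ _ (4 * C * C * s)).
      rewrite DE; have := x0z; nra.
    by rewrite ltr_pM2r.
  apply: (@le_trans _ _ (mu (ball x0 s))).
    apply: subset_measure_le; [exact: measurable_ball|exact: measurable_ball|].
    exact: ball_sub.
  move: sum_le comp; have := ball_lty x0 s0; have := ball_lty y s0.
  have : (0 <= mu (ball y s))%E by [].
  have : (0 <= mu (ball x0 s))%E by [].
  case: (mu (ball x0 s)) => [u| |]//; case: (mu (ball y s)) => [v| |]//.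
  rewrite -EFinD -EFinM !lee_fin => u0 v0 _ _ h1 h2.
  rewrite mulrAC ler_pdivlMr; nra.
have : (mu setT <= (kap / (1 + kap) * M)%:E)%E.
  have mB (k : nat) : measurable (ball x0 k.+1%:R) by exact: measurable_ball.
  have : mu \o (fun k : nat => ball x0 k.+1%:R) @ \oo -->
      mu (\bigcup_k ball x0 k.+1%:R).
    apply: nondecreasing_cvg_mu => //; first exact: bigcup_measurable.
    by move=> k l kl; apply/subsetPset/ball_sub; rewrite ler_nat.
  rewrite bigcup_ball; last first.
    move=> t; exists (Num.truncn t); exact: truncnS_gt.
  by move=> /cvge_to_le; apply; apply: nearW.
rewrite ME lee_fin mulrAC ler_pdivlMr; nra.
Qed.

(** At a level coarse enough, the ball inscribed in a cube has radius greater than the diameter of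
    [X]. *)
Lemma bounded_cube : (mu setT < +oo)%E -> exists n, cube n setT.
Proof.
move=> /exists_diameter[r hr].
have x0 : X by exact: point.
have N00 : 0 < `|N0| + 1 by rewrite ltr_wpDl.
have [k hk] := exists_radius_gt 0 (r * (`|N0| + 1) / eps0).
exists (0 - k%:Z).
have : dyadic_core Q !=set0.
  apply/set0P; apply/eqP => core0; have := mu_coreC; rewrite core0 setC0 => muT0.
  have := ball_gt0 x0 ltr01; rewrite ltNge => /negP; apply; rewrite -muT0.
  by apply: subset_measure_le => //; exact: measurable_ball.
move=> [x /(core_cube (0 - k%:Z))[A nA Ax]].
suff <- : A = setT by [].
apply/seteqP; split=> // y _; have [z Az zA] := cube_center nA.
apply: zA; rewrite /qball/=; apply: lt_trans (hr z y) _.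
rewrite ltr_pdivrMr// in hk.
by rewrite -(ltr_pM2l N00) mulrC [eps0 * _]mulrC mulrA.
Qed.

Lemma measurable_zeros : measurable [set x | f x = 0].
Proof.
by have := mf measurableT (measurable_set1 0); rewrite setTI.
Qed.

Lemma supp_setC : supp f = ~` [set x | f x = 0%R].
Proof. by apply/seteqP; split=> x /=; [move/eqP|move=> ?; exact/eqP]. Qed.

Lemma measurable_supp : measurable (supp f).
Proof. by rewrite supp_setC; apply: measurableC; exact: measurable_zeros. Qed.

Lemma mu_zeros_supp : mu setT = (mu [set x | f x = 0%R] + mu (supp f))%E.
Proof.
rewrite -measureU//; [|exact: measurable_zeros|exact: measurable_supp|].
  by rewrite supp_setC setUv.
by rewrite supp_setC setICr.
Qed.

Lemma vanishing_estimate : (mu setT < +oo)%E ->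
  (mu setT <= 4%:E * mu [set x | f x = 0%R])%E ->
  (\int[mu]_x FP x <=
   Kosc%:E * \int[mu]_x SP x)%E.
Proof.
move=> /bounded_cube[n nT] h0.
have := oscillation_estimate nT measurable_zeros (@subsetT _ _) h0.
rewrite [X in (_ + X)%E](_ : _ = 0)%E ?adde0//.
rewrite -[RHS](integral0 mu [set x | f x = 0%R]); apply: eq_integral => x.
by move=> /set_mem/= ->; rewrite normr0 powR0 ?gt_eqF// mul0e.
Qed.

(** If [f] vanishes on a quarter of the mass, the first term suffices. Otherwise [supp f] carries
    more than half of it, so [om X <= CW 2 * om (supp f)], and [local_estimate] on the cube [X]
    gives the other two terms. *)
Lemma finite_estimate : (mu setT < +oo)%E ->
  (\int[mu]_x FP x <=
   Kosc%:E * \int[mu]_x SP x +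
   Kloc%:E * (CW 2)%:E *
     (((mu setT)^-1 * Iabs setT) `^ p * om (supp f)) +
   Kloc%:E * \int[mu]_x SP x)%E.
Proof.
move=> muT; have [n nT] := bounded_cube muT.
have C1 : 0 <= CW 2 by rewrite (le_trans ler01)// CW_ge1// ler1n.
have SP0 : (0 <= \int[mu]_x SP x)%E by exact: integral_ge0.
have msupp := measurable_supp.
have m0 := cube_gt0 nT; have mfin := cube_fin_num nT.
have Ifin := cube_Iabs_fin nT.
have I0 : (0 <= Iabs setT)%E by apply: integral_ge0 => y _; rewrite lee_fin.
have [h0|h0] := leP (mu setT) (4%:E * mu [set x | f x = 0%R])%E.
  apply: le_trans (vanishing_estimate muT h0) _.
  rewrite -addeA leeDl// adde_ge0//; last by rewrite mule_ge0.
  by rewrite mule_ge0// ?mule_ge0// ?poweR_ge0// om_ge0.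
have hs : (mu setT <= 2%:E * mu (supp f))%E.
  move: h0 mfin; rewrite mu_zeros_supp.
  have : (0 <= mu [set x | f x = 0%R])%E by [].
  case: (mu [set x | f x = 0%R]) => [u| |]//; case: (mu (supp f)) => [v| |]//.
  rewrite -EFinM -!EFinD -EFinM lte_fin !lee_fin => u0 h _; lra.
have [_ omT] := cube_weight_le nT msupp (@subsetT _ _) hs.
have [Iz|In0] := eqVneq (Iabs setT) 0%E.
  rewrite (cube_FP_null nT Iz) adde_ge0//; last by rewrite mule_ge0.
  rewrite adde_ge0//; last by rewrite mule_ge0// ?mule_ge0// ?poweR_ge0// om_ge0.
  by rewrite mule_ge0.
pose a := fine (Iabs setT) / fine (mu setT).
have m0' : 0 < fine (mu setT) by rewrite fine_gt0// m0 ltey_eq mfin.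
have a0 : 0 < a.
  by rewrite divr_gt0// fine_gt0// lt0e In0 I0/= ltey_eq Ifin.
have Ia : Iabs setT = (a%:E * mu setT)%E.
  by rewrite -[in RHS](fineK mfin) -EFinM divfK ?gt_eqF// fineK.
have aE : ((mu setT)^-1 * Iabs setT = a%:E)%E.
  by rewrite -(fineK mfin) -(fineK Ifin) inver gt_eqF// -EFinM mulrC.
rewrite aE poweR_EFin.
have := local_estimate nT a0 (_ : Iabs setT <= a%:E * mu setT)%E.
rewrite {1}Ia lexx => /(_ isT)/le_trans; apply.
rewrite ge0_muleDr ?mule_ge0 ?lee_fin ?powR_ge0 ?om_ge0//; apply: leeD => //.
rewrite -[leLHS]add0e; apply: leeD.
  by rewrite mule_ge0.
by rewrite -muleA lee_wpmul2l// muleCA lee_wpmul2l// lee_fin powR_ge0.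
Qed.

End Norm.

End Function.

End Weight.

End Cubes.

(** * From integrals to norms *)

Lemma poweR_addr_le {R : realType} (s : R) (x y : \bar R) :
  0 <= s -> (0 <= x)%E -> (0 <= y)%E ->
  ((x + y) `^ s <= (2 `^ s)%:E * (x `^ s + y `^ s))%E.
Proof.
move=> s0; wlog xy : x y / (x <= y)%E => [wlg|] x0 y0.
  have [/wlg|/ltW/wlg] := leP x y; first exact.
  by rewrite addeC [(_ `^ s + _)%E]addeC; exact.
rewrite -poweR_EFin.
apply: (@le_trans _ _ ((2%:E * y) `^ s)%E).
  apply: gt0_ler_poweR => //; rewrite ?in_itv/= ?leey ?andbT.
  - exact: adde_ge0.
  - by rewrite mule_ge0.
  - by rewrite (_ : 2%:E = 1 + 1)%E// ge0_muleDl// mul1e leeD2r.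
rewrite poweRM ?lee_fin//; apply: lee_wpmul2l; first exact: poweR_ge0.
by rewrite leeDr// poweR_ge0.
Qed.

Theorem theorem2p3 (R : realType) (delta eps0 N0 : R -> R -> R)
    (K1 K2 p q K0 : R)
    (hdelta : 0 < delta K1 K2 < 1) (heps0 : 0 < eps0 K1 K2)
    (hp : 1 < p) (hq : 1 < q) (hK0 : 1 <= K0) :
  exists N eps1 : R, 0 < N /\ 0 < eps1 /\
  forall (d : measure_display) (X : measurableType d) (rho : X -> X -> R)
    (mu : {measure set X -> \bar R}) (I : int -> Type)
    (Q : forall n : int, I n -> set X) (w f : X -> R),
  homogeneous_space K1 K2 rho mu ->
  dyadic_filtration (delta K1 K2) (eps0 K1 K2) (N0 K1 K2) rho mu Q ->
  Ap_weight mu rho q w -> (Ap_constant mu rho q w <= K0%:E)%E ->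
  in_wLp mu p w f -> loc_integrable mu rho f ->
  let norm := wLnorm mu p w in
  let fsharp := dyadic_sharp mu Q f in
  ((mu setT < +oo)%E ->
     (norm (EFin \o f) <= N%:E * norm fsharp
        + N%:E * (mu setT)^-1 * weight_measure mu w (supp f) `^ p^-1
          * 'N[mu]_1[EFin \o f])%E /\
     forall (eps r0 : R) (x0 : X), 0 < eps -> 0 < r0 ->
       supp f `<=` qball rho x0 r0 ->
       (mu (qball rho x0 r0) <= eps%:E * mu setT)%E ->
       (norm (EFin \o f) <=
          N%:E * norm fsharp + (N * eps)%:E * norm (EFin \o f))%E /\
       (eps <= eps1 -> (norm (EFin \o f) <= N%:E * norm fsharp)%E)) /\
  ((mu setT = +oo)%E -> (norm (EFin \o f) <= N%:E * norm fsharp)%E).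
Proof.
set D := cube_doubling K1 K2 (delta K1 K2) (eps0 K1 K2) (N0 K1 K2).
pose CW M := K0 * (2 * (D * M)) `^ q.
pose Kosc := oscillation_constant (CW 2) (CW 16) D p.
pose Kloc := local_constant (CW 2) D p.
(* The bound [2] gives [N eps >= 1] as soon as [eps > 1/2]. The root covers the three terms of
   [finite_estimate], its factor [2] paying for the [1/p]-th power of a sum. *)
pose N := Num.max 2 ((2 * (Kosc + Kloc + Kloc * CW 2)) `^ p^-1).
have p0 : 0 < p by exact: lt_trans hp.
have N2 : 2 <= N by rewrite le_max lexx.
have N0' : 0 < N by exact: lt_le_trans N2.
(* The threshold is [1/2] because a support of at most half the mass leaves [f = 0] on the other
   half, more than the quarter asked by [vanishing_estimate]. *)
exists N, 2^-1; split=> //; split; first by rewrite invr_gt0.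
move=> d X rho mu I Q w f hom dya hw hA [mf fnorm] locf norm fsharp.
have D1 : 1 <= D by exact: cube_doubling_ge1.
have CW1 M : 1 <= M -> 1 <= CW M.
  by apply: scaled_powR_ge1 => //; rewrite ltW// (lt_trans ltr01).
have CW2 : 1 <= CW 2 by rewrite CW1// ler1n.
have Kloc0 : 0 <= Kloc by exact: local_constant_ge0.
have Kosc0 : 0 <= Kosc.
  rewrite mulr_ge0// !addr_ge0 ?powR_ge0// mulr_ge0 ?powR_ge0//.
  by rewrite (le_trans ler01)// CW1// ler1n.
have KC0 : 0 <= Kloc * CW 2 by rewrite mulr_ge0// (le_trans ler01).
have pV0 : 0 <= p^-1 by rewrite invr_ge0 ltW.
have norm_ge0 g : (0 <= norm g)%E by exact: poweR_ge0.
have Kosc_le : Kosc `^ p^-1 <= N.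
  rewrite le_max; apply/orP; right; apply: ge0_ler_powR; rewrite ?nnegrE//; lra.
have int_ge0 (g : X -> \bar R) : (0 <= \int[mu]_x (`|g x| `^ p * (w x)%:E))%E.
  by apply: integral_ge0 => x _; rewrite mule_ge0 ?poweR_ge0// lee_fin (Ap_ge0 hw).
have root_le : (\int[mu]_x (`|(EFin \o f) x| `^ p * (w x)%:E) <=
    Kosc%:E * \int[mu]_x (`|fsharp x| `^ p * (w x)%:E))%E ->
    (norm (EFin \o f) <= N%:E * norm fsharp)%E.
  move=> h; apply: (@le_trans _ _ ((Kosc `^ p^-1)%:E * norm fsharp)%E).
    rewrite -poweR_EFin /norm /wLnorm -poweRM ?lee_fin//.
    apply: gt0_ler_poweR => //; rewrite in_itv/= leey andbT.
      exact: (int_ge0 (EFin \o f)).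
    by apply: mule_ge0; [rewrite lee_fin|exact: int_ge0].
  by rewrite lee_wpmul2r ?lee_fin.
split=> [muT|muT]; last first.
  apply: root_le.
  apply: (infinite_estimate hom dya hdelta heps0 hq hK0 hw hA mf locf hp muT).
  by apply: (lty_poweRy _ fnorm); rewrite gt_eqF// invr_gt0.
have half eps (r0 : R) x0 : eps <= 2^-1 -> 0 < r0 -> supp f `<=` qball rho x0 r0 ->
    (mu (qball rho x0 r0) <= eps%:E * mu setT)%E ->
    (norm (EFin \o f) <= N%:E * norm fsharp)%E.
  move=> e2 r00 fB Be; apply: root_le.
  apply: (vanishing_estimate hom dya hdelta heps0 hq hK0 hw hA mf locf hp muT).
  have sB : (mu (supp f) <= eps%:E * mu setT)%E.
    apply: le_trans Be; apply: subset_measure_le => //.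
      exact: measurable_supp mf.
    apply: (homogeneous_measurable hom).
    exact: homogeneous_ball_open hom _ _ r00.
  move: muT sB; rewrite (mu_zeros_supp mu mf).
  have : (0 <= mu [set x | f x = 0%R])%E by [].
  have : (0 <= mu (supp f))%E by [].
  case: (mu [set x | f x = 0%R]) => [u| |]//; case: (mu (supp f)) => [v| |]//.
  rewrite -EFinD -!EFinM !lee_fin => v0 u0 _ h; nra.
split.
  have root_sum_le (F S Y : \bar R) : (0 <= F)%E -> (0 <= S)%E -> (0 <= Y)%E ->
      (F <= Kosc%:E * S + Kloc%:E * (CW 2)%:E * Y + Kloc%:E * S)%E ->
      (F `^ p^-1 <= N%:E * (S `^ p^-1 + Y `^ p^-1))%E.
    move=> F0 S0 Y0 h.
    set K := Kosc + Kloc + Kloc * CW 2 in N N2 N0' Kosc_le root_le half *.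
    have K0' : 0 <= K by rewrite /K; lra.
    have {}h : (F <= K%:E * (S + Y))%E.
      apply: (le_trans h); rewrite addeAC -EFinM -ge0_muleDl// -EFinD ge0_muleDr//.
      by apply: leeD; rewrite lee_wpmul2r// lee_fin /K; lra.
    apply: (@le_trans _ _ ((K%:E * (S + Y)) `^ p^-1)%E).
      by apply: gt0_ler_poweR => //; rewrite in_itv/= leey andbT// mule_ge0 ?adde_ge0.
    rewrite poweRM ?lee_fin ?adde_ge0//.
    apply: (@le_trans _ _
      (K%:E `^ p^-1 * ((2 `^ p^-1)%:E * (S `^ p^-1 + Y `^ p^-1)))%E).
      by apply: lee_wpmul2l; [exact: poweR_ge0|exact: poweR_addr_le].
    rewrite poweR_EFin muleA -EFinM -powRM// lee_wpmul2r ?adde_ge0 ?poweR_ge0//.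
    by rewrite lee_fin mulrC le_max lexx orbT.
  have om0 : (0 <= weight_measure mu w (supp f))%E.
    by apply: integral_ge0 => x _; rewrite lee_fin (Ap_ge0 hw).
  have I0 : (0 <= (mu setT)^-1 * \int[mu]_y `|f y|%:E)%E.
    apply: mule_ge0; first by rewrite inve_ge0.
    by apply: integral_ge0 => y _; rewrite lee_fin.
  have YE : ((((mu setT)^-1 * \int[mu]_y `|f y|%:E) `^ p *
        weight_measure mu w (supp f)) `^ p^-1 =
      (mu setT)^-1 * weight_measure mu w (supp f) `^ p^-1 * 'N[mu]_1[EFin \o f])%E.
    rewrite Lnorm1 poweRM ?poweR_ge0// -poweRrM mulfV ?gt_eqF// poweRe1//.
    by rewrite muleAC.
  rewrite -!muleA [((mu setT)^-1 * _)%E]muleA -YE.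
  rewrite -ge0_muleDr ?norm_ge0 ?poweR_ge0//; apply: root_sum_le.
  - exact: int_ge0.
  - exact: int_ge0.
  - by apply: mule_ge0 => //; exact: poweR_ge0.
  - exact: (finite_estimate hom dya hdelta heps0 hq hK0 hw hA mf locf hp muT).
move=> eps r0 x0 eps0' r00 fB Be; split=> [|epsle]; last exact: half epsle r00 fB Be.
have [e2|e2] := leP eps 2^-1.
  apply: le_trans (half _ _ _ e2 r00 fB Be) _.
  by rewrite leeDl// mule_ge0// lee_fin mulr_ge0// ltW.
rewrite -[leLHS]add0e; apply: leeD; first by rewrite mule_ge0// lee_fin ltW.
rewrite -[leLHS]mul1e; apply: lee_wpmul2r => //.
by rewrite lee_fin; nra.
Qed.
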